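(* Let $\mathcal{H}$ be a complex Hilbert space. If $u$ is a non-constant inner function and $T\in\mathcal{B}(\mathcal{H})$ is a completely non-unitary contraction, then $A_T=A_{u(T)}$.
   Context: For a contraction $T\in\mathcal{B}(\mathcal{H})$ (i.e. $\|T\|\leq1$), the asymptotic limit of $T$ is $A_T:=\lim_{n\to\infty}T^{*n}T^n$, the limit being in the strong operator topology (it exists since the sequence is decreasing and positive). A contraction $T$ is completely non-unitary (c.n.u.) if only the zero subspace reduces $T$ to a unitary operator. An inner function is a bounded analytic function $u$ on the open unit disc $\mathbb{D}$ whose radial boundary values have modulus $1$ almost everywhere on the unit circle. For a c.n.u. contraction $T$ and $u\in H^\infty(\mathbb{D})$, the operator $u(T)$ is defined by the Sz.-Nagy--Foias functional calculus, i.e. $u(T)=\lim_{r\to1-0}u(rT)$ in the strong operator topology, where $u(rT)=\sum_{n\ge0}c_nr^nT^n$ for $u(z)=\sum_{n\geq0}c_nz^n$; for inner $u$ the operator $u(T)$ is a contraction. *)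

(* Defs.v *)
From mathcomp Require Import all_boot all_order all_algebra.
From mathcomp Require Export complex.
From mathcomp Require Import all_classical all_reals all_analysis.

Set Implicit Arguments.
Unset Strict Implicit.
Unset Printing Implicit Defensive.

Import Order.TTheory GRing.Theory Num.Theory Num.Def.
Import numFieldNormedType.Exports.

Local Open Scope classical_set_scope.
Local Open Scope ring_scope.
Local Open Scope complex_scope.

(* The open unit disc; the order of R[i] only compares complex numbers with
   the same imaginary part, and `|z| is a nonnegative real element of R[i]. *)
Definition disc (R : realType) : set R[i] := [set z | `|z| < 1].

Definition expi (R : realType) (t : R) : R[i] := cos t +i* sin t.

(* u(z) = \sum_n c_n z^n on the open unit disc. *)
Definition disc_expansion (R : realType) (u : R[i] -> R[i]) (c : nat -> R[i]) :=
  forall z, disc z ->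
    [series (c n * z ^+ n : R[i]^o)]_n @ \oo --> (u z : R[i]^o).

Definition disc_analytic (R : realType) (u : R[i] -> R[i]) :=
  exists c, disc_expansion u c.

(* Unique for an analytic u. *)
Definition taylor_coef (R : realType) (u : R[i] -> R[i]) : nat -> R[i] :=
  xget (fun=> 0) [set c | disc_expansion u c].

Definition disc_bounded (R : realType) (u : R[i] -> R[i]) :=
  exists M, forall z, disc z -> `|u z| <= M.

(* The arc length measure of the unit circle is parametrised by the Lebesgue
   measure of [0, 2 pi[. The values of u outside the disc play no role. *)
Definition inner_function (R : realType) (u : R[i] -> R[i]) :=
  [/\ disc_analytic u, disc_bounded u &
    {ae (@lebesgue_measure R), forall t : R, 0 <= t < 2 * pi ->
      exists2 w : R[i], `|w| = 1 &
        (u (r%:C * expi t) : R[i]^o) @[r --> (1 : R)^'-] --> (w : R[i]^o)}].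

Definition constant_on_disc (R : realType) (u : R[i] -> R[i]) :=
  exists k, forall z, disc z -> u z = k.

(* The norm of a Hilbert space is the one induced by the inner product, which
   is linear in its first argument and conjugate-linear in the second one. *)
Definition hilbert_norm (R : realType) (H : completeNormedModType R[i])
    (dot : {dot H for (@conjC R[i])}) :=
  forall x : H, `|x| ^+ 2 = dot x x.

(* The Hilbert adjoint: adjoint dot T y is the unique z such that
   <T x, y> = <x, z> for all x; it exists when T is linear and bounded. *)
Definition adjoint (R : realType) (H : completeNormedModType R[i])
    (dot : {dot H for (@conjC R[i])}) (T : H -> H) (y : H) : H :=
  xget 0 [set z | forall x, dot (T x) y = dot x z].

(* For a linear T, this says that the operator norm of T is at most 1. *)
Definition contractive (R : realType) (H : completeNormedModType R[i])
    (T : H -> H) := forall x, `|T x| <= `|x|.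

(* Limits in the strong operator topology are pointwise limits. *)
Definition asymptotic_limit (R : realType) (H : completeNormedModType R[i])
    (dot : {dot H for (@conjC R[i])}) (T : H -> H) (x : H) : H :=
  lim (iter n (adjoint dot T) (iter n T x) @[n --> \oo]).

Definition closed_subspace (R : realType) (H : completeNormedModType R[i])
    (M : set H) :=
  [/\ closed M, M 0 & forall (a : R[i]) x y, M x -> M y -> M (a *: x + y)].

Definition reducing (R : realType) (H : completeNormedModType R[i])
    (dot : {dot H for (@conjC R[i])}) (T : H -> H) (M : set H) :=
  closed_subspace M /\
  forall x, M x -> M (T x) /\ M (adjoint dot T x).

(* When M reduces T, the adjoint of the restriction of T to M is the
   restriction to M of the adjoint of T. *)
Definition unitary_on (R : realType) (H : completeNormedModType R[i])
    (dot : {dot H for (@conjC R[i])}) (T : H -> H) (M : set H) :=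
  forall x, M x -> adjoint dot T (T x) = x /\ T (adjoint dot T x) = x.

Definition completely_nonunitary (R : realType)
    (H : completeNormedModType R[i]) (dot : {dot H for (@conjC R[i])})
    (T : H -> H) :=
  forall M : set H, reducing dot T M -> unitary_on dot T M -> M = [set 0].

(* u(r T) = \sum_n c_n r^n T^n, evaluated at x. *)
Definition calculus_scaled (R : realType) (H : completeNormedModType R[i])
    (u : R[i] -> R[i]) (r : R) (T : H -> H) (x : H) : H :=
  lim ([series (taylor_coef u n * r%:C ^+ n) *: iter n T x]_n @ \oo).

(* The Sz.-Nagy--Foias calculus: u(T) is the strong limit of u(r T) as r tends
   to 1 from the left. *)
Definition calculus (R : realType) (H : completeNormedModType R[i])
    (u : R[i] -> R[i]) (T : H -> H) (x : H) : H :=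
  lim (calculus_scaled u r T x @[r --> (1 : R)^'-]).

(* Main.v *)
(**
Write a(x) for the limit of |T^n x|^2 and b(x) for that of |F^n x|^2, where
F = u(T); these are the quadratic forms of the two asymptotic limits, so it
suffices to show a = b. The main tool is the von Neumann inequality for an
arbitrary semidefinite form s that T contracts, with its defect term: if
p = p(0) + z q and |p| <= 1 on the circle, then
s(p(T) x) + s(q(T) x) - s(T q(T) x) <= s(x).

Complete non-unitarity enters through an induction principle: a closed subspace
G that contains all (1 - T T^* )h, and contains x if and only if it contains
T x, is the whole space, since its orthogonal complement reduces T to a unitary
operator. Two estimates, |p(T)(1 - T T^* )h| <= |p|_2 |h| and
|p(T) x|^2 - |T p(T) x|^2 <= |p|_2^2 |x|^2, where |p|_2 is the l^2 norm of the
coefficients, then show that p(T) x is small when p is bounded on the circle and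
|p|_2 is small. This replaces the unitary dilation in the proof that u(rT) x
converges as r tends to 1.

For an inner function u = sum c_n z^n, the means of |u|^(2m) on circles tend
to 1, so |u| <= 1 on the disc and sum |c_n|^2 = 1; if u is not constant then
|c_0| < 1.

a o F = a: the form a - a o F is semidefinite, and by the induction principle it
is enough to show that it vanishes at y = (1 - T T^* )h. On polynomials,
|h|^2 |p|_2^2 - a(p(T) y) is semidefinite and multiplication by z is isometric
for it; the von Neumann inequality and |u|_2 = 1 give a(F y) >= a(y).

b o T = b: let d = b - b o T. The defect term of the von Neumann inequality and
b o F = b give d((F - c_0) x) = 0, hence d(x) = d(F x) = |c_0|^2 d(x), and
d = 0.

Finally a(x) = a(F^n x) <= |F^n x|^2 gives a <= b, and b(x) = b(T^n x) gives
b <= a.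
*)
From HB Require Import structures.
Require Import Defs.
From mathcomp Require Import all_boot all_order all_algebra.
From mathcomp Require Import all_classical all_reals all_analysis.
From mathcomp Require Import cyclic separable cyclotomic measurable_realfun ring lra.

Set Implicit Arguments.
Unset Strict Implicit.
Unset Printing Implicit Defensive.

Import Order.TTheory GRing.Theory Num.Theory.
Import numFieldNormedType.Exports.

Local Open Scope classical_set_scope.
Local Open Scope ring_scope.
Local Open Scope complex_scope.

Local Notation Re := complex.Re.
Local Notation Im := complex.Im.
(* Otherwise x^* would mean Num.conj or the convertible conjc, depending on the
   scope of the position. *)
Local Notation "x ^*" := (Num.conj x) : complex_scope.

(** * Semidefinite hermitian forms *)

Section Complex.
Variable R : realType.
Implicit Types (z w : R[i]) (a : R).

(* The squared modulus as an element of R: `|z| lives in R[i], whose order is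
   only partial. *)
Definition nsq z : R := Re z ^+ 2 + Im z ^+ 2.

Lemma ReD z w : Re (z + w) = Re z + Re w. Proof. by case: z; case: w. Qed.
Lemma ReN z : Re (- z) = - Re z. Proof. by case: z. Qed.
Lemma ImD z w : Im (z + w) = Im z + Im w. Proof. by case: z; case: w. Qed.
Lemma ImN z : Im (- z) = - Im z. Proof. by case: z. Qed.
Lemma ReM z w : Re (z * w) = Re z * Re w - Im z * Im w.
Proof. by case: z; case: w. Qed.
Lemma ImM z w : Im (z * w) = Re z * Im w + Im z * Re w.
Proof. by case: z; case: w => /= *; rewrite addrC. Qed.
Lemma Re_conj z : Re (z^*) = Re z. Proof. by case: z. Qed.
Lemma Im_conj z : Im (z^*) = - Im z. Proof. by case: z. Qed.

Lemma Re_sum (I : Type) (r : seq I) (P : pred I) (F : I -> R[i]) :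
  Re (\sum_(i <- r | P i) F i) = \sum_(i <- r | P i) Re (F i).
Proof. exact: (big_morph _ ReD). Qed.

Lemma nsq_ge0 z : 0 <= nsq z.
Proof. by rewrite addr_ge0// sqr_ge0. Qed.

Lemma nsqM z w : nsq (z * w) = nsq z * nsq w.
Proof. by rewrite /nsq ReM ImM; ring. Qed.

Lemma nsq0 : nsq 0 = 0. Proof. by rewrite /nsq/= expr0n addr0. Qed.
Lemma nsq1 : nsq 1 = 1. Proof. by rewrite /nsq/= expr0n addr0 expr1n. Qed.

Lemma nsq_real a : nsq a%:C = a ^+ 2.
Proof. by rewrite /nsq/= [0 ^+ 2]expr0n addr0. Qed.

Lemma nsq_conj z : nsq (z^*) = nsq z.
Proof. by rewrite /nsq Re_conj Im_conj sqrrN. Qed.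

Lemma nsqX z n : nsq (z ^+ n) = nsq z ^+ n.
Proof. by elim: n => [|n IH]; rewrite ?expr0 ?nsq1// !exprS nsqM IH. Qed.

Lemma nsqE z : (nsq z)%:C = `|z| ^+ 2.
Proof. exact: add_Re2_Im2. Qed.

Lemma nsqN z : nsq (- z) = nsq z.
Proof. by rewrite /nsq ReN ImN !sqrrN. Qed.

Lemma conj_realC a : (a%:C)^* = a%:C.
Proof. exact: conjc_real. Qed.

Lemma mul_conjC z : z * z^* = (nsq z)%:C.
Proof. by rewrite nsqE sqr_normc. Qed.

Lemma normcE_nsq z : `|z| = (Num.sqrt (nsq z))%:C.
Proof. exact: normc_def. Qed.

Lemma nsq_eq0 z : (nsq z == 0) = (z == 0).
Proof.
apply/eqP/eqP => [h|->]; last exact: nsq0.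
by apply/eqP; rewrite -normr_eq0 normcE_nsq h sqrtr0.
Qed.

Lemma nsqD_le z w : nsq (z + w) <= 2 * nsq z + 2 * nsq w.
Proof.
rewrite /nsq ReD ImD; have := sqr_ge0 (Re z - Re w).
by have := sqr_ge0 (Im z - Im w); nra.
Qed.

End Complex.

(** Degenerate forms are allowed, since defects and asymptotic forms are rarely definite. Bounding
    the real part of [s x x] suffices: hermitian symmetry makes this value real. *)
Definition psd_form (R : realType) (V : lmodType R[i]) (s : V -> V -> R[i]) :=
  [/\ forall z, scalar (s^~ z), forall x y, s y x = (s x y)^* &
      forall x, 0 <= Re (s x x)].

Definition qform (R : realType) (V : lmodType R[i]) (s : V -> V -> R[i]) x :=
  Re (s x x).

Section PsdForm.
Variables (R : realType) (V : lmodType R[i]) (s : V -> V -> R[i]).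
Hypothesis s_psd : psd_form s.
Implicit Types (x y z : V) (a : R[i]).

Local Notation Q := (qform s).

Lemma psdP a x y z : s (a *: x + y) z = a * s x z + s y z.
Proof. by case: s_psd => + _ _; move=> /(_ z a x y). Qed.

Lemma psdC x y : s y x = (s x y)^*. Proof. by case: s_psd. Qed.

Lemma qform_ge0 x : 0 <= Q x. Proof. by case: s_psd => _ _ /(_ x). Qed.

Lemma psdDl x y z : s (x + y) z = s x z + s y z.
Proof. by rewrite -{1}[x]scale1r psdP mul1r. Qed.

Lemma psd0l z : s 0 z = 0.
Proof. by apply: (addrI (s 0 z)); rewrite -psdDl !addr0. Qed.

Lemma psdZl a x z : s (a *: x) z = a * s x z.
Proof. by rewrite -[a *: x]addr0 psdP psd0l addr0. Qed.

Lemma psdDr x y z : s x (y + z) = s x y + s x z.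
Proof. by rewrite psdC psdDl rmorphD/= -!psdC. Qed.

Lemma psdZr a x z : s x (a *: z) = a^* * s x z.
Proof. by rewrite psdC psdZl rmorphM/= -psdC. Qed.

Lemma psd0r x : s x 0 = 0.
Proof. by rewrite psdC psd0l rmorph0. Qed.

Lemma psd_suml (I : Type) (r : seq I) (P : pred I) (F : I -> V) z :
  s (\sum_(i <- r | P i) F i) z = \sum_(i <- r | P i) s (F i) z.
Proof. exact: (big_morph (s^~ z) (fun x y => psdDl x y z) (psd0l z)). Qed.

Lemma psd_sumr (I : Type) (r : seq I) (P : pred I) (F : I -> V) z :
  s z (\sum_(i <- r | P i) F i) = \sum_(i <- r | P i) s z (F i).
Proof. exact: (big_morph (s z) (fun x y => psdDr z x y) (psd0r z)). Qed.

Lemma psd_self x : s x x = (Q x)%:C.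
Proof.
have := psdC x x; rewrite /qform; case: (s x x) => a b /= [/eqP].
by rewrite -subr_eq0 opprK -mulr2n mulrn_eq0/= => /eqP ->.
Qed.

Lemma qform0 : Q 0 = 0. Proof. by rewrite /qform psd0l. Qed.

Lemma qformZ a x : Q (a *: x) = nsq a * Q x.
Proof.
rewrite {1}/qform psdZl psdZr mulrA mul_conjC psd_self ReM/=.
by rewrite mul0r subr0.
Qed.

Lemma qformN x : Q (- x) = Q x.
Proof.
rewrite -scaleN1r qformZ -(rmorphN1 (real_complex R)) nsq_real sqrrN expr1n.
by rewrite mul1r.
Qed.

Lemma qformD x y : Q (x + y) = Q x + Q y + 2 * Re (s x y).
Proof.
rewrite /qform psdDl !psdDr [s y x]psdC !ReD Re_conj; ring.
Qed.

Lemma qformB x y : Q (x - y) = Q x + Q y - 2 * Re (s x y).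
Proof.
by rewrite qformD qformN -scaleN1r psdZr rmorphN1 mulN1r ReN mulrN.
Qed.

Lemma qformDB x y : Q (x + y) + Q (x - y) = 2 * Q x + 2 * Q y.
Proof. rewrite qformD qformB; ring. Qed.

Lemma qformD_le x y : Q (x + y) <= 2 * Q x + 2 * Q y.
Proof. by rewrite -qformDB lerDl qform_ge0. Qed.

Lemma qform_le x y : Q x <= 2 * Q (x - y) + 2 * Q y.
Proof. by rewrite -[x in leLHS](subrK y) qformD_le. Qed.

Lemma qform_triangle4 x y z w :
  Q (x - w) <= 2 * Q (x - y) + 4 * Q (y - z) + 4 * Q (w - z).
Proof.
have -> : x - w = (x - y) + ((y - z) + - (w - z)) by rewrite opprB !addrA !subrK.
have := qformD_le (x - y) ((y - z) + - (w - z)).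
have := qformD_le (y - z) (- (w - z)); rewrite qformN; lra.
Qed.

Lemma psd_CauchySchwarz x y : nsq (s x y) <= Q x * Q y.
Proof.
(* This is the value of [Q] at [x - e * s x y *: y] for a real [e]. *)
have key (e : R) : 0 <= Q x - 2 * e * nsq (s x y) + e ^+ 2 * nsq (s x y) * Q y.
  have := qform_ge0 (x - (e%:C * s x y) *: y).
  rewrite qformB qformZ psdZr nsqM nsq_real.
  suff -> : (e%:C * s x y)^* * s x y = (e * nsq (s x y))%:C by rewrite /=; lra.
  by rewrite rmorphM/= -mulrA [_^* * s x y]mulrC mul_conjC; simpc.
have [Qy0|Qy0] := eqVneq (Q y) 0; last first.
  have Qyp : 0 < Q y by rewrite lt_def Qy0 qform_ge0.
  have := key (Q y)^-1.
  rewrite -(pmulr_lge0 _ Qyp).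
  suff -> : (Q x - 2 * (Q y)^-1 * nsq (s x y) + (Q y)^-1 ^+ 2 * nsq (s x y) * Q y)
    * Q y = Q x * Q y - nsq (s x y) by rewrite subr_ge0.
  by field.
rewrite Qy0 mulr0; rewrite Qy0 in key.
have [->//|N0] := eqVneq (nsq (s x y)) 0.
(* With [Q y = 0] the bound is affine in [e], and this [e] would make it equal to [- Q x - 2]. *)
have := key ((Q x + 1) / nsq (s x y)).
by rewrite mulr0 addr0 -mulrA divfK//; have := qform_ge0 x; lra.
Qed.

Lemma Re_psd_le x y (A B : R) : Q x <= A -> Q y <= B ->
  Re (s x y) ^+ 2 <= A * B.
Proof.
move=> xA yB; apply: (@le_trans _ _ (nsq (s x y))).
  by rewrite lerDl sqr_ge0.
apply: le_trans (psd_CauchySchwarz x y) _.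
by apply: ler_pM => //; exact: qform_ge0.
Qed.

(** Cauchy-Schwarz for a sum of scaled vectors, by induction on its length and free of square
    roots. *)
Lemma qform_sum_le (n : nat) (a : nat -> R[i]) (x : nat -> V) :
  Q (\sum_(i < n) a i *: x i) <= (\sum_(i < n) nsq (a i)) * \sum_(i < n) Q (x i).
Proof.
elim: n => [|n IH]; first by rewrite !big_ord0 qform0 mulr0.
rewrite !big_ord_recr/= qformD qformZ psdZr.
set S := \sum_(i < n) a i *: x i in IH *.
set A := \sum_(i < n) nsq (a i) in IH *; set B := \sum_(i < n) Q (x i) in IH *.
have A0 : 0 <= A by apply: sumr_ge0 => i _; exact: nsq_ge0.
have B0 : 0 <= B by apply: sumr_ge0 => i _; exact: qform_ge0.
have N0 := nsq_ge0 (a n); have q0 := qform_ge0 (x n).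
have : Re (s S (a n *: x n)) ^+ 2 <= (A * B) * (nsq (a n) * Q (x n)).
  by apply: Re_psd_le => //; rewrite qformZ.
rewrite psdZr; set t := Re _ => ht.
(* Here [t ^+ 2 <= X * Y] for the two summands X and Y on the right, and (X - Y)^2 >= 0 turns this
   into 2t <= X + Y. *)
suff : 2 * t <= A * Q (x n) + nsq (a n) * B by lra.
have X0 : 0 <= A * Q (x n) by rewrite mulr_ge0.
have Y0 : 0 <= nsq (a n) * B by rewrite mulr_ge0.
rewrite leNgt; apply/negP => lt_t.
have : (A * Q (x n) + nsq (a n) * B) ^+ 2 < (2 * t) ^+ 2.
  by rewrite ltr_pXn2r// nnegrE ?addr_ge0//; lra.
have := sqr_ge0 (A * Q (x n) - nsq (a n) * B).
move: ht; set X := A * Q (x n); set Y := nsq (a n) * B.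
have -> : A * B * (nsq (a n) * Q (x n)) = X * Y by rewrite /X /Y; ring.
nra.
Qed.

End PsdForm.

(** * Toeplitz operators and the von Neumann inequality *)

Section PolyOp.
Variables (R : realType) (V : lmodType R[i]).
Implicit Types (T : {linear V -> V}) (p q : {poly R[i]}) (x y : V).

Definition polyop (T : V -> V) p x := \sum_(i < size p) p`_i *: iter i T x.

Lemma polyopE (T : V -> V) p x n : (size p <= n)%N ->
  polyop T p x = \sum_(i < n) p`_i *: iter i T x.
Proof.
move=> pn; rewrite -(subnKC pn) big_split_ord/= [X in _ + X]big1 ?addr0// => i _.
by rewrite nth_default ?scale0r// leq_addr.
Qed.

Lemma polyopD (T : V -> V) p q x :
  polyop T (p + q) x = polyop T p x + polyop T q x.
Proof.
have np := leq_maxl (size p) (size q); have nq := leq_maxr (size p) (size q).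
rewrite (polyopE _ _ (size_polyD p q)) (polyopE _ _ np) (polyopE _ _ nq).
by rewrite -big_split; apply: eq_bigr => i _; rewrite coefD scalerDl.
Qed.

Lemma polyopZ (T : V -> V) a p x : polyop T (a *: p) x = a *: polyop T p x.
Proof.
rewrite (polyopE _ _ (size_scale_leq a p)) scaler_sumr.
by apply: eq_bigr => i _; rewrite coefZ scalerA.
Qed.

Lemma polyopB (T : V -> V) p q x :
  polyop T (p - q) x = polyop T p x - polyop T q x.
Proof. by rewrite polyopD -[- q]scaleN1r polyopZ scaleN1r. Qed.

Lemma polyopC (T : V -> V) a x : polyop T a%:P x = a *: x.
Proof.
by rewrite (polyopE _ _ (size_polyC_leq1 a)) big_ord1 coefC/=.
Qed.

Lemma polyop_poly (T : V -> V) n (a : nat -> R[i]) x :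
  polyop T (\poly_(i < n) a i) x = \sum_(i < n) a i *: iter i T x.
Proof.
rewrite (polyopE _ _ (size_poly n a)); apply: eq_bigr => i _.
by rewrite coef_poly ltn_ord.
Qed.

Lemma iter_linear T n : linear (iter n T).
Proof. by elim: n => [|n IH] a x y //=; rewrite IH linearP. Qed.

Lemma polyop_linear T p : linear (polyop T p).
Proof.
move=> a x y; rewrite /polyop scaler_sumr -big_split; apply: eq_bigr => i _.
by rewrite iter_linear scalerDr !scalerA mulrC.
Qed.

Lemma polyop_comm T (S : {linear V -> V}) p x :
    (forall z, T (S z) = S (T z)) ->
  polyop T p (S x) = S (polyop T p x).
Proof.
move=> TS; rewrite /polyop linear_sum; apply: eq_bigr => i _.
rewrite linearZ; congr (_ *: _).
by elim: (nat_of_ord i) => //= n ->.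
Qed.

Lemma polyopMX T p x : polyop T (p * 'X) x = T (polyop T p x).
Proof.
have h : (size (p * 'X)%R <= (size p).+1)%N.
  by have [->|p0] := eqVneq p 0; rewrite ?mul0r ?size_poly0// size_mulX.
rewrite (polyopE _ _ h) big_ord_recl coefMX/= scale0r add0r linear_sum.
by apply: eq_bigr => i _; rewrite coefMX/= linearZ.
Qed.

Lemma polyop_iter T p n x : polyop T p (iter n T x) = iter n T (polyop T p x).
Proof. by elim: n => //= n <-; rewrite polyop_comm. Qed.

End PolyOp.

(** * The discrete Fourier transform and the Toeplitz bound *)

Section Toeplitz.
Variables (R : realType).

(** X^n - 1 splits over [R[i]] and is separable, so it has n distinct roots; among n distinct n-th
    roots of unity one is primitive. *)
Lemma prim_root_exists n : (0 < n)%N -> exists z : R[i], n.-primitive_root z.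
Proof.
move=> n_gt0; have [r rE] := closed_field_poly_normal ('X^n - 1 : {poly R[i]}).
have rootr z : z \in r = root ('X^n - 1) z.
  by rewrite rE (monicP (monicXnsubC _ n_gt0)) scale1r root_prod_XsubC.
have size_r : size r = n.
  have := congr1 (fun p : {poly _} => size p) rE.
  rewrite size_XnsubC// size_scale ?size_prod_XsubC; first by case.
  by rewrite (monicP (monicXnsubC _ n_gt0)) oner_neq0.
have : has n.-primitive_root r.
  apply: has_prim_root => //; last by rewrite size_r.
    by apply/allP => z; rewrite rootr.
  rewrite -separable_prod_XsubC; move: rE.
  rewrite (monicP (monicXnsubC _ n_gt0)) scale1r => <-.
  by apply: separable_Xn_sub_1; rewrite pnatr_eq0 -lt0n.
by case/hasP => z _; exists z.
Qed.

Lemma nsq_unity n (z : R[i]) : (0 < n)%N -> z ^+ n = 1 -> nsq z = 1.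
Proof.
move=> n_gt0 zn; have := nsqX z n; rewrite zn nsq1 => /esym/eqP.
by rewrite -[X in _ == X](expr1n _ n) eqrXn2 ?nsq_ge0// => /eqP.
Qed.

Lemma sum_expr_unity n (z : R[i]) : z ^+ n = 1 -> z != 1 ->
  \sum_(j < n) z ^+ j = 0.
Proof.
move=> zn z1; have := subrX1 z n; rewrite zn subrr => /esym/eqP.
by rewrite mulf_eq0 subr_eq0 (negbTE z1) => /eqP.
Qed.

Variables (V : lmodType R[i]) (s : V -> V -> R[i]).
Hypothesis s_psd : psd_form s.
Local Notation Q := (qform s).

(** Parseval for the Fourier transform on Z/L with vector values: expand both arguments of the form
    and use the orthogonality of the characters. *)
Lemma Parseval_unity L (w : R[i]) (g : nat -> V) : L.-primitive_root w ->
  \sum_(j < L) Q (\sum_(n < L) w ^+ (j * n) *: g n) = L%:R * \sum_(n < L) Q (g n).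
Proof.
move=> wL; have L0 := prim_order_gt0 wL; have wL1 := prim_expr_order wL.
have w1 := nsq_unity L0 wL1.
have nw n : w ^+ n * (w ^+ n)^* = 1 by rewrite mul_conjC nsqX w1 expr1n.
have -> : \sum_(j < L) Q (\sum_(n < L) w ^+ (j * n) *: g n) =
   Re (\sum_(n < L) \sum_(m < L) (\sum_(j < L) (w ^+ n * (w ^+ m)^*) ^+ j) * s (g n) (g m)).
  rewrite -Re_sum; congr (Re _).
  under eq_bigr => j _.
    rewrite (psd_suml s_psd); under eq_bigr => n _.
      rewrite (psd_sumr s_psd); under eq_bigr => m _.
        rewrite (psdZl s_psd) (psdZr s_psd) mulrA.
        rewrite (_ : _ * (_ : R[i])^* = (w ^+ n * (w ^+ m)^*) ^+ j).
          over.
        by rewrite exprMn -!exprM -rmorphXn/= -exprM ![(j * _)%N]mulnC.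
      over.
    over.
  rewrite exchange_big; apply: eq_bigr => n _; rewrite exchange_big.
  by apply: eq_bigr => m _; rewrite mulr_suml.
rewrite Re_sum mulr_sumr; apply: eq_bigr => n _; rewrite (bigD1 n)//= nw.
rewrite [X in _ + X]big1 ?addr0 => [|m mn].
  under eq_bigr do rewrite expr1n.
  by rewrite sumr_const card_ord (psd_self s_psd) -mulr_natl mulr1
    -(rmorph_nat (real_complex R)) -rmorphM.
rewrite sum_expr_unity ?mul0r//.
  by rewrite exprMn -rmorphXn/= -!exprM ![(_ * L)%N]mulnC !exprM wL1 !expr1n rmorph1 mulr1.
apply/eqP => /(congr1 ( *%R^~ (w ^+ m))); rewrite mul1r -mulrA [_^* * _]mulrC nw mulr1.
move/eqP; rewrite (eq_prim_root_expr wL) !modn_small ?ltn_ord// => /eqP/val_inj nm.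
by rewrite nm eqxx in mn.
Qed.

Lemma periodic_sum (W : zmodType) L k (f : nat -> W) : (forall n, f (n + L)%N = f n) ->
  \sum_(n < L) f (n + k)%N = \sum_(n < L) f n.
Proof.
move=> fL; elim: k => [|k <-]; first by under eq_bigr do rewrite addn0.
case: L fL => [|L] fL; first by rewrite !big_ord0.
rewrite [RHS]big_ord_recl [LHS]big_ord_recr/= addrC; congr (_ + _).
  by rewrite add0n addnS -addSn addnC fL.
by apply: eq_bigr => i _; rewrite addnS.
Qed.

(** The operator sum of p_k S^k, with S the backward shift, becomes a convolution on a cyclic group
    Z/L; the Fourier transform diagonalises it with the eigenvalues p(w^(-j)), all on the circle. *)
Lemma Toeplitz_le (p : {poly R[i]}) (M : R) (g : nat -> V) (N : nat) :
    (forall z, nsq z = 1 -> nsq p.[z] <= M) ->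
    (forall n, (N <= n)%N -> g n = 0) ->
  \sum_(n < N) Q (\sum_(k < size p) p`_k *: g (n + k)%N) <= M * \sum_(n < N) Q (g n).
Proof.
(* For n < N and k < [size p] the index n + k stays below [L], so the periodic extension [h] agrees
   with [g] wherever the sums look. *)
move=> pM gN; pose L := (N + (size p).+1)%N.
have L0 : (0 < L)%N by rewrite /L addnS.
have [w wL] := prim_root_exists L0; have wL1 := prim_expr_order wL.
have w1 := nsq_unity L0 wL1.
pose h n := g (n %% L)%N.
have hL n : h (n + L)%N = h n by rewrite /h modnDr.
pose f n := \sum_(k < size p) p`_k *: h (n + k)%N.
have gh n : (n < L)%N -> h n = g n by move=> nL; rewrite /h modn_small.
apply: (@le_trans _ _ (\sum_(n < L) Q (f n))).
  rewrite /L big_split_ord/= ler_wpDr//; first by apply: sumr_ge0 => i _; exact: qform_ge0.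
  rewrite le_eqVlt; apply/orP; left; apply/eqP; apply: eq_bigr => n _; congr (Q _).
  apply: eq_bigr => k _; rewrite gh// /L.
  by rewrite -addSn; apply: leq_add => //; rewrite leqW// ltnW.
have -> : \sum_(n < N) Q (g n) = \sum_(n < L) Q (h n).
  rewrite /L big_split_ord/= [X in _ = _ + X]big1 ?addr0.
    by apply: eq_bigr => n _; rewrite gh// /L ltn_addr.
  by move=> i _; rewrite gh ?ltn_add2l// gN ?leq_addr// qform0.
have LR : 0 < L%:R :> R by rewrite ltr0n.
rewrite -(ler_pM2l LR) mulrCA -!(Parseval_unity _ wL) mulr_sumr.
apply: ler_sum => j _.
(* A cyclic shift by k multiplies the j-th Fourier sum by w^(-jk). *)
have -> : \sum_(n < L) w ^+ (j * n) *: f n =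
    p.[(w ^+ j)^-1] *: \sum_(n < L) w ^+ (j * n) *: h n.
  rewrite horner_coef scaler_suml.
  under eq_bigr do rewrite /f scaler_sumr.
  rewrite exchange_big/=; apply: eq_bigr => k _.
  rewrite -[X in _ *: X](@periodic_sum _ _ k (fun n => w ^+ (j * n) *: h n)); last first.
    by move=> n; rewrite hL mulnDr exprD (mulnC j L) (exprM w L) wL1 expr1n mulr1.
  rewrite scaler_sumr; apply: eq_bigr => n _; rewrite !scalerA; congr (_ *: _).
  rewrite mulrC -mulrA; congr (_ * _).
  have wj0 : w ^+ j != 0 by rewrite -nsq_eq0 nsqX w1 expr1n oner_eq0.
  by rewrite mulnDr exprD mulrCA (exprM w j k) -exprMn mulVf// expr1n mulr1.
rewrite (qformZ s_psd) ler_wpM2r ?qform_ge0// pM//.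
by apply: (nsq_unity L0); rewrite exprVn -exprM mulnC exprM wL1 expr1n invr1.
Qed.

End Toeplitz.

(** * The von Neumann inequality with its defect term *)

Section VonNeumann.
Variables (R : realType) (V : lmodType R[i]) (s : V -> V -> R[i]).
Hypothesis s_psd : psd_form s.
Local Notation Q := (qform s).
Implicit Types (T : {linear V -> V}) (p q : {poly R[i]}) (M : R).

Lemma circle_bound_ge0 p M : (forall z, nsq z = 1 -> nsq p.[z] <= M) -> 0 <= M.
Proof. by move=> /(_ 1 (nsq1 R)); apply: le_trans; exact: nsq_ge0. Qed.

(** The form of 1 - T^*T relative to [s], written without an adjoint for [s]. *)
Definition defect_form (T : V -> V) x y := s x y - s (T x) (T y).

Lemma qform_defect (T : V -> V) x : qform (defect_form T) x = Q x - Q (T x).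
Proof. by rewrite /qform /defect_form ReD ReN. Qed.

Lemma sum_qform_defect (T : V -> V) n x :
  \sum_(m < n) qform (defect_form T) (iter m T x) = Q x - Q (iter n T x).
Proof.
elim: n => [|n IH]; first by rewrite big_ord0 subrr.
by rewrite big_ord_recr IH qform_defect/=; ring.
Qed.

Lemma psd_defect T : (forall x, Q (T x) <= Q x) -> psd_form (defect_form T).
Proof.
rewrite /defect_form => TQ; split=> [z a x y|x y|x].
- by rewrite linearP !(psdP s_psd) mulrBr opprD addrACA.
- by rewrite rmorphB/= -!(psdC s_psd).
- by rewrite ReD ReN subr_ge0; exact: TQ.
Qed.

(** Since defects along an orbit telescope, [Toeplitz_le] is applied in the defect form to the orbit
    of x preceded by one zero. Position 0 of the output is q(T)x and gives the defect term; position
    m + 1 is T^m p(T)x, and these defects add up to Q(p(T)x) up to a vanishing rest. *)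
Let von_neumann_pure T q a M x :
    (forall x, Q (T x) <= Q x) ->
    (forall y e, 0 < e -> exists N, Q (iter N T y) <= e) ->
    (forall z, nsq z = 1 -> nsq (q * 'X + a%:P).[z] <= M) ->
  Q (polyop T (q * 'X + a%:P) x) +
    (Q (polyop T q x) - Q (T (polyop T q x))) <= M * Q x.
Proof.
set p := q * 'X + _ => TQ T0 pM; have M0 := circle_bound_ge0 pM.
have dpsd := psd_defect TQ; set d := defect_form T in dpsd.
have dE y : qform d y = Q y - Q (T y) := qform_defect T y.
have tele n y : \sum_(m < n) qform d (iter m T y) = Q y - Q (iter n T y) :=
  sum_qform_defect T n y.
apply/ler_addgt0Pr => e e0; have [N NQ] := T0 (polyop T p x) e e0.
(* The orbit is cut at [K], late enough that the outputs at the positions 0 to [N] do not see the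
   cut. *)
pose K := (N + size p + size q)%N.
pose g n := if (0 < n <= K)%N then iter n.-1 T x else 0.
have gK n : (K.+1 <= n)%N -> g n = 0 by move=> Kn; rewrite /g [(n <= K)%N]leqNgt Kn/= andbF.
have := Toeplitz_le dpsd pM gK.
have -> : \sum_(n < K.+1) qform d (g n) = Q x - Q (iter K T x).
  rewrite big_ord_recl/= /g/= (qform0 dpsd) add0r -tele; apply: eq_bigr => i _.
  by rewrite /bump/= add1n ltn_ord.
pose h n := \sum_(k < size p) p`_k *: g (n + k)%N.
have h0 : h 0%N = polyop T q x.
  have pq : (size p <= (size p + size q).+1)%N by rewrite leqW// leq_addr.
  have -> : h 0%N = \sum_(k < (size p + size q).+1) p`_k *: g k.
    rewrite -(subnKC pq) big_split_ord/= [X in _ = _ + X]big1 ?addr0// => i _.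
    by rewrite nth_default ?scale0r// leq_addr.
  rewrite big_ord_recl {1}/g/= scaler0 add0r (polyopE _ _ (leq_addl (size p) _)).
  apply: eq_bigr => i _; rewrite /bump/= add1n /p coefD coefMX coefC/= addr0 /g/=.
  by rewrite ifT//; apply: leq_trans (ltn_ord i) _; rewrite /K -addnA leq_addl.
have hS m : (m < N)%N -> h m.+1 = iter m T (polyop T p x).
  move=> mN; rewrite -polyop_iter; apply: eq_bigr => k _; congr (_ *: _).
  rewrite /g addSn/= ifT; first by rewrite -iterD addnC.
  by rewrite /K (leq_trans _ (leq_addr _ _))// -addSn leq_add// ltnW.
move=> le_h.
have : \sum_(n < N.+1) qform d (h n) <= M * Q x.
  apply: le_trans (_ : _ <= \sum_(n < K.+1) qform d (h n)) _.
    have NK : (N.+1 <= K.+1)%N by rewrite ltnS /K -addnA leq_addr.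
    rewrite -(subnKC NK) [leRHS]big_split_ord/= lerDl.
    by apply: sumr_ge0 => i _; exact: qform_ge0.
  apply: le_trans le_h _; apply: ler_wpM2l => //.
  by rewrite gerBl qform_ge0.
rewrite big_ord_recl/= h0 dE.
under eq_bigr => i _ do rewrite /bump/= add1n hS//.
rewrite tele; lra.
Qed.

(** Lets r tend to 1 in an inequality about rT although the space carries no topology here. *)
Lemma qform_scale_poly n (v : nat -> V) :
  exists P : {poly R}, forall r : R, Q (\sum_(i < n) r%:C ^+ i *: v i) = P.[r].
Proof.
exists (\sum_(i < n) \sum_(j < n) (Re (s (v i) (v j)))%:P * 'X^(i + j)) => r.
rewrite {1}/qform (psd_suml s_psd) Re_sum horner_sum; apply: eq_bigr => i _.
rewrite (psd_sumr s_psd) Re_sum horner_sum; apply: eq_bigr => j _.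
rewrite (psdZl s_psd) (psdZr s_psd) mulrA !hornerE exprD.
have rC k : r%:C ^+ k = (r ^+ k)%:C by rewrite rmorphXn.
by rewrite !rC conj_realC -rmorphM ReM/= mul0r subr0 mulrC.
Qed.

Lemma poly_ge0_at1 (P : {poly R}) : (forall r : R, 0 <= r < 1 -> 0 <= P.[r]) ->
  0 <= P.[1].
Proof.
move=> P0; have : P.[r] @[r --> (1:R)^'-] --> P.[1].
  by apply: cvg_at_left_filter; exact: continuous_horner.
move=> cP; rewrite -(cvg_lim _ cP)//; apply: limr_ge; first by apply/cvg_ex; exists P.[1].
near=> r; apply: P0; apply/andP; split; last by near: r; exact: nbhs_left_lt.
by near: r; exact: nbhs_left_ge.
Unshelve. all: by end_near.
Qed.

(** For 0 <= r < 1 the iterates of rT decay, so the pure case applies to rT; both sides are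
    polynomials in r and the inequality survives at r = 1. *)
Theorem von_neumann_defect T q a M x :
    (forall x, Q (T x) <= Q x) ->
    (forall z, nsq z = 1 -> nsq (q * 'X + a%:P).[z] <= M) ->
  Q (polyop T (q * 'X + a%:P) x) +
    (Q (polyop T q x) - Q (T (polyop T q x))) <= M * Q x.
Proof.
set p := q * 'X + _ => TQ pM.
have iterZ (r : R) n y : iter n (r%:C \*: T) y = r%:C ^+ n *: iter n T y.
  by elim: n => [|n IH]; rewrite ?scale1r//= IH linearZ scalerA -exprS.
have opZ (r : R) f : polyop (r%:C \*: T) f x =
    \sum_(i < size f) r%:C ^+ i *: (f`_i *: iter i T x).
  by apply: eq_bigr => i _; rewrite iterZ !scalerA mulrC.
have [P PE] := qform_scale_poly (size p) (fun i => p`_i *: iter i T x).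
have [P1 P1E] := qform_scale_poly (size q) (fun i => q`_i *: iter i T x).
have [P2 P2E] := qform_scale_poly (size q) (fun i => T (q`_i *: iter i T x)).
have opT (r : R) : T (polyop (r%:C \*: T) q x) =
    \sum_(i < size q) r%:C ^+ i *: T (q`_i *: iter i T x).
  by rewrite opZ linear_sum; apply: eq_bigr => i _; rewrite linearZ.
have op1 f : polyop ((1 : R)%:C \*: T) f x = polyop T f x.
  by rewrite opZ; apply: eq_bigr => i _; rewrite expr1n scale1r.
(* [F] is the right side minus the left side for rT; the factor 'X^2 comes from Q(rTy) = r^2
   Q(Ty). *)
pose F := (M * Q x)%:P - P - (P1 - 'X^2 * P2).
have FE r : F.[r] = M * Q x - Q (polyop (r%:C \*: T) p x) -
    (Q (polyop (r%:C \*: T) q x) - r ^+ 2 * Q (T (polyop (r%:C \*: T) q x))).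
  by rewrite /F !hornerE -PE -P1E -P2E -!opZ -opT.
suff : 0 <= F.[1] by rewrite FE !op1 expr1n mul1r; lra.
apply: poly_ge0_at1 => r /andP[r0 r1]; rewrite FE.
have Tr y : Q ((r%:C \*: T) y) = r ^+ 2 * Q (T y).
  by rewrite /= (qformZ s_psd) nsq_real.
rewrite -Tr subr_ge0 lerBrDl; apply: von_neumann_pure => //.
- move=> y; rewrite Tr; apply: le_trans (TQ y).
  by rewrite ler_piMl ?qform_ge0// expr_le1// ltW.
- move=> y e e0.
  have Qn n : Q (iter n (r%:C \*: T) y) <= (r ^+ 2) ^+ n * Q y.
    elim: n => [|n IH]; first by rewrite mul1r.
    rewrite iterS Tr [(r ^+ 2) ^+ n.+1]exprS -mulrA ler_wpM2l ?sqr_ge0//.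
    exact: le_trans (TQ _) IH.
  have c0 : (r ^+ 2) ^+ n * Q y @[n --> \oo] --> (0 : R).
    rewrite -(mul0r (Q y)); apply: cvgM; last exact: cvg_cst.
    apply: cvg_expr.
    by rewrite normrX ger0_norm// expr_lt1.
  have /cvgrPdist_le/(_ e e0)[N _ /(_ N (leqnn N))] := c0.
  rewrite /= sub0r normrN => leN; exists N; apply: le_trans (Qn N) _.
  exact: le_trans (ler_norm _) leN.
Qed.

Corollary von_neumann T p M x :
    (forall x, Q (T x) <= Q x) ->
    (forall z, nsq z = 1 -> nsq p.[z] <= M) ->
  Q (polyop T p x) <= M * Q x.
Proof.
elim/poly_ind: p => [_|q a _ TQ pM].
  move=> /circle_bound_ge0 M0; rewrite /polyop size_poly0 big_ord0 (qform0 s_psd).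
  by rewrite mulr_ge0// qform_ge0.
apply: le_trans (von_neumann_defect x TQ pM).
by rewrite lerDl subr_ge0 TQ.
Qed.

(** Cauchy-Schwarz in the defect form, whose values along the orbit of x have sums at most [Q x]. *)
Lemma defect_polyop_le T p x : (forall x, Q (T x) <= Q x) ->
  Q (polyop T p x) - Q (T (polyop T p x)) <= (\sum_(i < size p) nsq p`_i) * Q x.
Proof.
move=> TQ; have dpsd := psd_defect TQ; rewrite -qform_defect.
apply: le_trans (qform_sum_le dpsd _ (fun i => p`_i) (fun i => iter i T x)) _.
rewrite sum_qform_defect ler_wpM2l//; first by apply: sumr_ge0 => i _; exact: nsq_ge0.
by rewrite gerBl qform_ge0.
Qed.

End VonNeumann.

(** * Hilbert spaces and contractions *)

Lemma inv_nat_small (R : realType) (e : R) : 0 < e ->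
  exists N, forall n, (N <= n)%N -> n.+1%:R^-1 <= e.
Proof.
move=> e0; exists (Num.truncn e^-1) => n le_n.
rewrite invf_ple ?posrE//; apply: ltW; apply: lt_le_trans (truncnS_gt _) _.
by rewrite ler_nat ltnS.
Qed.

Section Hilbert.
Variables (R : realType) (H : completeNormedModType R[i]).
Variables (dot : {dot H for (@Num.conj R[i])}).
Hypothesis dot_norm : hilbert_norm dot.
Implicit Types (x y z : H) (M : set H).

Local Notation Q := (qform dot).

Lemma dot_psd : psd_form dot.
Proof.
split=> [z a x y|x y|x]; first by rewrite linearPl.
  by rewrite hermC expr0 mul1r.
by have := dnorm_ge0 dot x; rewrite lecE => /andP[_].
Qed.

Lemma sqr_norm x : `|x| ^+ 2 = (Q x)%:C.
Proof. by rewrite dot_norm (psd_self dot_psd). Qed.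

Lemma norm_le (e : R) x : 0 <= e -> (`|x| <= e%:C) = (Q x <= e ^+ 2).
Proof.
move=> e0; rewrite -(@ler_pXn2r _ 2)// ?nnegrE ?ler0c//.
by rewrite sqr_norm -rmorphXn lecR.
Qed.

Lemma norm_le2 x y : (`|x| <= `|y|) = (Q x <= Q y).
Proof. by rewrite -(@ler_pXn2r _ 2 isT _ _ (normr_ge0 x) (normr_ge0 y)) !sqr_norm lecR. Qed.

Lemma qform_eq0 x : Q x = 0 -> x = 0.
Proof.
move=> Qx; apply/eqP; rewrite -normr_eq0 -sqrf_eq0.
by apply/eqP; rewrite sqr_norm Qx.
Qed.

Lemma posc_real (e : R[i]) : 0 < e -> exists2 a : R, 0 < a & e = a%:C.
Proof.
case: e => a b; rewrite ltcE /= => /andP[/eqP -> a0].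
by exists a.
Qed.

(** The norm has its values in [R[i]]; this passes to the real number [Q (f t - l)], in which all
    later estimates are made. *)
Lemma cvg_qform (T : Type) (F : set_system T) (FF : Filter F) (f : T -> H) l :
  f t @[t --> F] --> l <-> forall e : R, 0 < e -> \forall t \near F, Q (f t - l) <= e.
Proof.
split=> [/cvgrPdist_le fl e e0|fl].
  have s0 : 0 < (Num.sqrt e)%:C by rewrite ltcR sqrtr_gt0.
  apply: filterS (fl _ s0) => t; rewrite norm_le ?sqrtr_ge0//.
  by rewrite sqr_sqrtr ?(ltW e0)// -(qformN dot_psd) opprB.
apply/cvgrPdist_le => _ /posc_real[a a0 ->].
have a20 : 0 < a ^+ 2 by rewrite exprn_gt0.
apply: filterS (fl _ a20) => t.
by rewrite norm_le ?(ltW a0)// -(qformN dot_psd) opprB.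
Qed.

Lemma cvg_qform_seq (f : nat -> H) l : f n @[n --> \oo] --> l <->
  forall e : R, 0 < e -> exists N, forall n, (N <= n)%N -> Q (f n - l) <= e.
Proof.
rewrite cvg_qform; split=> fl e /fl; first by case=> N _ h; exists N.
by case=> N h; exists N.
Qed.

Lemma qform_cauchy (T : Type) (F : set_system T) (FF : ProperFilter F) (f : T -> H) :
  (forall e : R, 0 < e -> exists t0, \forall t \near F, Q (f t - f t0) <= e) ->
  cvg (f t @[t --> F]).
Proof.
move=> fl; apply: cauchy_cvg; apply: cauchy_exP => _ /posc_real[a a0 ->].
have a20 : 0 < (a / 2) ^+ 2 by rewrite exprn_gt0// divr_gt0.
have [t0 t0P] := fl _ a20; exists (f t0); rewrite /= near_simpl.
apply: filterS t0P => t; rewrite -norm_le ?divr_ge0 ?(ltW a0)// => le_a.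
rewrite -ball_normE /ball_/= distrC; apply: le_lt_trans le_a _.
by rewrite ltcR ltr_pdivrMr// ltr_pMr// ltr1n.
Qed.

Lemma closed_qformP M : closed M <->
  forall x, (forall e : R, 0 < e -> exists2 y, M y & Q (x - y) <= e) -> M x.
Proof.
split=> [Mc x xM|xM x Mx].
  apply: Mc => B /nbhs_normP[_ /posc_real[a a0 ->]] aB.
  have a20 : 0 < (a / 2) ^+ 2 by rewrite exprn_gt0// divr_gt0.
  have [y My] := xM _ a20; rewrite -norm_le ?divr_ge0 ?(ltW a0)// => le_a.
  exists y; split => //; apply: aB; rewrite /ball_/=; apply: le_lt_trans le_a _.
  by rewrite ltcR ltr_pdivrMr// ltr_pMr// ltr1n.
apply: xM => e e0; have s0 : 0 < (Num.sqrt e)%:C by rewrite ltcR sqrtr_gt0.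
have [y [My]] := Mx _ (nbhsx_ballx x _ s0).
rewrite -ball_normE /ball_/= => /ltW; rewrite norm_le ?sqrtr_ge0//.
by rewrite sqr_sqrtr ?(ltW e0)//; exists y.
Qed.

(** A minimising sequence for the distance is Cauchy by the parallelogram law, and its limit is the
    projection. *)
Lemma projection_exists M x : closed_subspace M ->
  exists2 y, M y & forall z, M z -> dot (x - y) z = 0.
Proof.
move=> [/closed_qformP Mc M0 ML].
pose D := [set Q (x - y) | y in M].
have Dlb : has_inf D.
  split; first by exists (Q (x - 0)); exists 0.
  by exists 0 => _ [y _ <-]; exact: (qform_ge0 dot_psd).
have infD y : M y -> inf D <= Q (x - y).
  by move=> My; apply: ge_inf; [case: Dlb|exists y].
have /choice[f fP] n : exists y, M y /\ Q (x - y) <= inf D + n.+1%:R^-1.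
  have n0 : 0 < n.+1%:R^-1 :> R by rewrite invr_gt0.
  have [_ [y My <-] /ltW le_y] := inf_adherent n0 Dlb.
  by exists y.
have MB y z : M y -> M z -> M (2^-1%:C *: (y + z)).
  move=> My Mz; rewrite -[_ *: _]addr0; apply: (ML) => //.
  by rewrite -[y]scale1r; exact: ML.
(* The midpoint of [f n] and [f m] lies in M, so its squared distance to x is at least [inf D]. *)
have fcauchy n m : Q (f n - f m) <= 2 * n.+1%:R^-1 + 2 * m.+1%:R^-1.
  have [Mn lin] := fP n; have [Mm lem] := fP m.
  have := qformDB dot_psd (x - f n) (x - f m).
  have -> : x - f n - (x - f m) = - (f n - f m).
    by rewrite opprD opprK addrACA subrr add0r opprB addrC.
  rewrite (qformN dot_psd).
  have -> : x - f n + (x - f m) = 2%:R%:C *: (x - 2^-1%:C *: (f n + f m)).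
    rewrite scalerBr scalerA -rmorphM divff ?pnatr_eq0// scale1r rmorph_nat.
    by rewrite scaler_nat mulr2n addrACA opprD.
  rewrite (qformZ dot_psd) nsq_real.
  have := infD _ (MB _ _ Mn Mm); rewrite (_ : 2 ^+ 2 = 4); last by ring.
  move: lin lem; set a := n.+1%:R^-1; set b := m.+1%:R^-1; lra.
have : cvg (f n @[n --> \oo]).
  apply: qform_cauchy => e e0.
  have [N NP] := inv_nat_small (divr_gt0 e0 (ltr0n _ 4)).
  exists N; exists N => // n /= Nn; apply: le_trans (fcauchy n N) _.
  have := NP _ Nn; have := NP _ (leqnn N).
  by move: (n.+1%:R^-1) (N.+1%:R^-1) => a b; lra.
case/cvg_ex => /= y /cvg_qform_seq fy.
exists y => [|z Mz].
  apply: Mc => e /fy[N NP]; exists (f N); first by case: (fP N).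
  by rewrite -(qformN dot_psd) opprB NP.
apply/eqP; rewrite -nsq_eq0 eq_le nsq_ge0 andbT; apply/ler_addgt0Pr => e e0.
rewrite add0r.
have Qz0 := qform_ge0 dot_psd z; have Qz1 : 0 < Q z + 1 by lra.
(* Two errors [d * Q z], each doubled by [nsqD_le], give 4 d Q(z) <= e; the summand 1 covers
   [Q z = 0]. *)
pose d := e / (4 * (Q z + 1)); have d0 : 0 < d by rewrite divr_gt0// mulr_gt0.
have [N NP] := fy d d0; have [N' NP'] := inv_nat_small d0.
pose n := maxn N N'.
have fn : Q (f n - y) <= d by apply: NP; exact: leq_maxl.
have nd : n.+1%:R^-1 <= d by apply: NP'; exact: leq_maxr.
have [Mn le_n] := fP n.
have dz : 4 * d * Q z <= e.
  have -> : e = 4 * d * (Q z + 1) by rewrite /d; field; lra.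
  by rewrite ler_wpM2l//; [rewrite mulr_ge0// ltW|rewrite lerDl].
have A1 : nsq (dot (f n - y) z) <= d * Q z.
  by apply: le_trans (psd_CauchySchwarz dot_psd _ _) _; rewrite ler_wpM2r.
suff A2 : nsq (dot (x - f n) z) <= d * Q z.
  have -> : x - y = (x - f n) + (f n - y) by rewrite addrA subrK.
  by rewrite (psdDl dot_psd); apply: le_trans (nsqD_le _ _) _; lra.
have [Qz|Qz] := eqVneq (Q z) 0.
  by apply: le_trans (psd_CauchySchwarz dot_psd _ _) _; rewrite Qz !mulr0.
set w := x - f n in le_n *; set c := dot w z.
(* The point of the line through [f n] along z that is closest to x: moving there lowers the squared
   distance by |c|^2 / Q(z), hence by at most 1/(n+1). *)
have := infD (((Q z)^-1%:C * c) *: z + f n) (ML _ _ _ Mz Mn).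
have -> : x - (((Q z)^-1%:C * c) *: z + f n) = w - ((Q z)^-1%:C * c) *: z.
  by rewrite opprD addrCA addrC.
rewrite (qformB dot_psd) (qformZ dot_psd) (psdZr dot_psd) -/c nsqM nsq_real.
have -> : ((Q z)^-1%:C * c)^* * c = ((Q z)^-1 * nsq c)%:C.
  by rewrite rmorphM/= conj_realC -mulrA [c^* * c]mulrC mul_conjC -rmorphM.
have -> : (Q z)^-1 ^+ 2 * nsq c * Q z = (Q z)^-1 * nsq c by field.
rewrite /= => le_inf.
have : (Q z)^-1 * nsq c <= d.
  move: le_inf le_n nd; move: ((Q z)^-1 * nsq c) (n.+1%:R^-1 : R) => a b.
  by clearbody d; lra.
by rewrite ler_pdivrMl ?[Q z * d]mulrC// lt_def Qz.
Qed.

(** The kernel of f is closed. If w is a nonzero vector orthogonal to it, then x - (f x / f w) w is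
    in the kernel, so a multiple of w represents f. *)
Lemma Riesz_representation (f : H -> R[i]) (C : R) : scalar f ->
  (forall x, nsq (f x) <= C * Q x) -> exists z, forall x, f x = dot x z.
Proof.
move=> fL fC.
have f0 : f 0 = 0 by have := fL (-1) 0 0; rewrite scaler0 addr0 mulN1r addNr.
have fB x y : f (x - y) = f x - f y.
  by have := fL (-1) y x; rewrite scaleN1r mulN1r ![- _ + _]addrC.
have C0 : 0 <= `|C| by [].
have fC' x : nsq (f x) <= `|C| * Q x.
  by apply: le_trans (fC x) _; rewrite ler_wpM2r ?qform_ge0 ?ler_norm//; exact: dot_psd.
pose M := [set x | f x = 0].
have MS : closed_subspace M.
  split; [|exact: f0|by move=> a x y fx fy; rewrite /M/= fL fx fy mulr0 addr0].
  apply/closed_qformP => x xM /=; apply/eqP; rewrite -nsq_eq0 eq_le nsq_ge0 andbT.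
  apply/ler_addgt0Pr => e e0; rewrite add0r.
  have C1 : 0 < `|C| + 1 by lra.
  have [y /= fy le_y] := xM (e / (`|C| + 1)) (divr_gt0 e0 C1).
  have -> : f x = f (x - y) by rewrite fB fy subr0.
  apply: le_trans (fC' _) _; apply: le_trans (ler_wpM2l C0 le_y) _.
  by rewrite mulrCA ler_piMr ?(ltW e0)// ler_pdivrMr// mul1r lerDl.
have [fall|/existsNP[x0 fx0]] := pselect (forall x, f x = 0).
  by exists 0 => x; rewrite fall (psd0r dot_psd).
have [y My wM] := projection_exists x0 MS; set w := x0 - y in wM.
have fw : f w != 0 by rewrite fB My subr0; apply/eqP.
have Qw : Q w != 0.
  by apply: contra_neq fw => /qform_eq0 ->.
exists (((f w) / (Q w)%:C)^* *: w) => x.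
have : M (x - (f x / f w) *: w).
  rewrite /M/= fB; have := fL (f x / f w) w 0; rewrite addr0 f0 addr0 => ->.
  by rewrite divfK// subrr.
move/wM; rewrite (psdC dot_psd) => /eqP; rewrite conjC_eq0 => /eqP.
rewrite -[_ *: w]opprK (psdDl dot_psd) opprK -scaleNr (psdZl dot_psd).
rewrite (psd_self dot_psd) mulNr => /eqP; rewrite subr_eq0 => /eqP xw.
rewrite (psdZr dot_psd) conjCK xw; field; rewrite fw/=.
by rewrite -(rmorph0 (real_complex R)) (inj_eq (@complexI R)).
Qed.

End Hilbert.

(** * Limits of complex sequences through squared moduli *)

Section ComplexSequences.
Variable R : realType.
Implicit Types (u v : nat -> R[i]) (k l : R[i]).

Definition cvg_nsq u l :=
  forall e : R, 0 < e -> exists N, forall n, (N <= n)%N -> nsq (u n - l) <= e.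

Lemma cvg_nsq_unique u k l : cvg_nsq u k -> cvg_nsq u l -> k = l.
Proof.
move=> uk ul; apply/eqP; rewrite -subr_eq0 -nsq_eq0 eq_le nsq_ge0 andbT.
apply/ler_addgt0Pr => e e0; rewrite add0r.
have e4 : 0 < e / 4 by lra.
have [N1 h1] := uk _ e4; have [N2 h2] := ul _ e4.
have := h1 _ (leq_maxl N1 N2); have := h2 _ (leq_maxr N1 N2).
move: (u _) => w h3 h4; have -> : k - l = (w - l) + - (w - k) by ring.
by apply: le_trans (nsqD_le _ _) _; rewrite nsqN; lra.
Qed.

Lemma cvg_nsq_lin u v k l (a : R[i]) : cvg_nsq u k -> cvg_nsq v l ->
  cvg_nsq (fun n => a * u n + v n) (a * k + l).
Proof.
move=> uk vl e e0; have a1 : 0 < 4 * (nsq a + 1) by have := nsq_ge0 a; lra.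
have [N1 h1] := uk _ (divr_gt0 e0 a1).
have e4 : 0 < e / 4 by lra.
have [N2 h2] := vl _ e4; exists (maxn N1 N2) => n.
rewrite geq_max => /andP[/h1 n1 /h2 n2].
have -> : a * u n + v n - (a * k + l) = a * (u n - k) + (v n - l) by ring.
apply: le_trans (nsqD_le _ _) _; rewrite nsqM.
suff : nsq a * nsq (u n - k) <= e / 4 by lra.
apply: (@le_trans _ _ ((nsq a + 1) * (e / (4 * (nsq a + 1))))).
  by apply: ler_pM => //; rewrite ?nsq_ge0// lerDl.
rewrite le_eqVlt; apply/orP; left; apply/eqP; field.
by have := nsq_ge0 a; lra.
Qed.

Lemma cvg_nsq_conj u k : cvg_nsq u k -> cvg_nsq (fun n => (u n)^*) k^*.
Proof.
move=> uk e /uk[N h]; exists N => n /h.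
by rewrite -rmorphB nsq_conj.
Qed.

Lemma cvg_nsq_shift u k : cvg_nsq u k -> cvg_nsq (fun n => u n.+1) k.
Proof. by move=> uk e /uk[N h]; exists N => n Nn; apply: h; exact: leqW. Qed.

Lemma Re_sqr_le (z : R[i]) : Re z ^+ 2 <= nsq z.
Proof. by rewrite lerDl sqr_ge0. Qed.

Lemma cvg_nsq_Re u k : cvg_nsq u k -> Re (u n) @[n --> \oo] --> Re k.
Proof.
move=> uk; apply/cvgrPdist_le => e e0.
have [N h] := uk _ (exprn_gt0 2 e0); exists N => // n /= /h.
move/(le_trans (Re_sqr_le _)); rewrite ReD ReN distrC.
rewrite -[X in X <= _ -> _]real_normK ?num_real//.
by rewrite ler_pXn2r ?nnegrE ?normr_ge0 ?(ltW e0).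
Qed.

End ComplexSequences.

(** * Adjoints, asymptotic limits and asymptotic forms *)

Section Contraction.
Variables (R : realType) (H : completeNormedModType R[i]).
Variables (dot : {dot H for (@Num.conj R[i])}).
Hypothesis dot_norm : hilbert_norm dot.
Implicit Types (x y z : H) (M : set H).

Local Notation Q := (qform dot).

Lemma dot_inj y z : (forall x, dot x y = dot x z) -> y = z.
Proof.
move=> yz; apply/eqP; rewrite -subr_eq0; apply/eqP/(qform_eq0 dot_norm).
rewrite /qform -[- z]scaleN1r (psdDr (dot_psd dot)) (psdZr (dot_psd dot)).
by rewrite yz rmorphN1 mulN1r subrr.
Qed.

Lemma dot_injl y z : (forall x, dot y x = dot z x) -> y = z.
Proof.
by move=> yz; apply: dot_inj => x; rewrite !(psdC (dot_psd dot) _ x) yz.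
Qed.

Variable T : {linear H -> H}.
Hypothesis T_contr : forall x, Q (T x) <= Q x.

Local Notation T' := (adjoint dot T).

(** The default value in [adjoint] does not occur: x -> <Tx, y> is bounded by Cauchy-Schwarz, so
    Riesz representation provides the vector. *)
Lemma adjointP x y : dot (T x) y = dot x (T' y).
Proof.
rewrite /adjoint; case: xgetP => [z _ /(_ x)//|noz].
have [z zP] : exists z, forall x, dot (T x) y = dot x z.
  apply: (@Riesz_representation _ _ _ dot_norm _ (Q y)).
    by move=> a u v; rewrite linearP (psdP (dot_psd dot)).
  move=> u; apply: le_trans (psd_CauchySchwarz (dot_psd dot) _ _) _.
  by rewrite mulrC ler_wpM2l// qform_ge0//; exact: dot_psd.
by case: (noz z).
Qed.

Lemma adjointPl x y : dot (T' x) y = dot x (T y).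
Proof. by rewrite (psdC (dot_psd dot)) -adjointP -(psdC (dot_psd dot)). Qed.

Lemma adjoint_linear : linear T'.
Proof.
move=> a x y; apply: dot_inj => z; have P := dot_psd dot.
by rewrite -adjointP !(psdDr P) !(psdZr P) !adjointP.
Qed.

Lemma adjoint_contr y : Q (T' y) <= Q y.
Proof.
have P := dot_psd dot; have Q0 := qform_ge0 P.
have [->|Qy0] := eqVneq (Q (T' y)) 0; first exact: Q0.
have Qy : 0 < Q (T' y) by rewrite lt_def Qy0 Q0.
rewrite -(ler_pM2l Qy) -expr2 -nsq_real -(psd_self P) -adjointP.
apply: le_trans (psd_CauchySchwarz P _ _) _.
by apply: ler_wpM2r => //; exact: T_contr.
Qed.

Lemma dot_iter_adjoint n x y : dot (iter n T x) y = dot x (iter n T' y).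
Proof. by elim: n x y => //= n IH x y; rewrite adjointP IH -iterSr. Qed.

Lemma iter_contr n m x : (n <= m)%N -> Q (iter m T x) <= Q (iter n T x).
Proof.
move/subnK <-; elim: (m - n)%N => //= k IH.
by apply: le_trans IH; exact: T_contr.
Qed.

(** For n <= m the form s of T'^n T^n - T'^m T^m is semidefinite and below Q. With w the difference
    of the two vectors, Cauchy-Schwarz gives Q(w)^2 <= s(x,x) Q(w), so Q(w) is at most the drop of
    the convergent sequence |T^n x|^2. *)
Lemma asymptotic_limit_cvg x :
  iter n T' (iter n T x) @[n --> \oo] --> asymptotic_limit dot T x.
Proof.
suff : cvg (iter n T' (iter n T x) @[n --> \oo]) by [].
have P := dot_psd dot.
pose q n := Q (iter n T x).
have q_dec m n : (n <= m)%N -> q m <= q n by exact: iter_contr.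
have key m n : (n <= m)%N ->
    Q (iter m T' (iter m T x) - iter n T' (iter n T x)) <= q n - q m.
  move=> nm; set w := _ - _.
  pose s y z := dot (iter n T y) (iter n T z) - dot (iter m T y) (iter m T z).
  have s_psd : psd_form s.
    split=> [c a y z|y z|y].
    - by rewrite /s !iter_linear !(psdP P) mulrBr opprD addrACA.
    - by rewrite /s rmorphB/= -!(psdC P).
    - by rewrite /s ReD ReN subr_ge0; exact: iter_contr.
  have sw y : s x y = - dot w y.
    rewrite /s !dot_iter_adjoint /w (psdDl P) -[- iter n T' _]scaleN1r (psdZl P).
    rewrite mulN1r opprD opprK addrC ![dot (iter _ _ _) y](psdC P).
    by rewrite -!dot_iter_adjoint -!(psdC P) !dot_iter_adjoint.
  have swq : nsq (s x w) = Q w ^+ 2.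
    by rewrite sw nsqN (psd_self P) nsq_real.
  have := psd_CauchySchwarz s_psd x w; rewrite swq.
  have -> : qform s x = q n - q m by rewrite /qform /s ReD ReN.
  have : qform s w <= Q w.
    rewrite /qform /s ReD ReN; apply: (@le_trans _ _ (Q (iter n T w))).
      by rewrite gerBl; exact: (qform_ge0 P).
    exact: (@iter_contr 0 n).
  have : 0 <= q n - q m by rewrite subr_ge0 q_dec.
  have := qform_ge0 P w; have := qform_ge0 s_psd w.
  set A := q n - q m; set B := Q w; set C := qform s w => C0 B0 A0 CB.
  have [->//|B1] := eqVneq B 0.
  have Bp : 0 < B by rewrite lt_def B1.
  by move=> h; rewrite -(ler_pM2r Bp) -expr2; apply: le_trans h _; rewrite ler_wpM2l.
have q_cvg : cvg (q n @[n --> \oo]).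
  apply: nonincreasing_is_cvgn; first by move=> n m; exact: q_dec.
  by exists 0 => _ [n _ <-]; exact: (qform_ge0 P).
apply: (qform_cauchy dot_norm) => e e0.
have /cvgrPdist_le/(_ (e / 2) (divr_gt0 e0 (ltr0n _ 2)))[N _ NP] := q_cvg.
exists N; exists N => // n /= Nn; apply: le_trans (key _ _ Nn) _.
have := NP _ (leqnn N); have := NP _ Nn; rewrite !ler_distl; lra.
Qed.

Definition asymptotic_form x y : R[i] := dot (asymptotic_limit dot T x) y.

Lemma cvg_nsq_dot (f : nat -> H) x y : f n @[n --> \oo] --> x ->
  cvg_nsq (fun n => dot (f n) y) (dot x y).
Proof.
move=> fx e e0; have P := dot_psd dot.
have Q1 : 0 < Q y + 1 by have := qform_ge0 P y; lra.
have [N NP] := (cvg_qform_seq dot_norm f x).1 fx _ (divr_gt0 e0 Q1).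
exists N => n /NP le_n.
have -> : dot (f n) y - dot x y = dot (f n - x) y.
  by rewrite (psdDl P) -[- x]scaleN1r (psdZl P) mulN1r.
apply: le_trans (psd_CauchySchwarz P _ _) _.
apply: (@le_trans _ _ (e / (Q y + 1) * (Q y + 1))); last by rewrite divfK// gt_eqF.
by apply: ler_pM => //; rewrite ?(qform_ge0 P)// lerDl.
Qed.

Lemma asymptotic_form_cvg x y :
  cvg_nsq (fun n => dot (iter n T x) (iter n T y)) (asymptotic_form x y).
Proof.
have := cvg_nsq_dot y (@asymptotic_limit_cvg x); have P := dot_psd dot.
congr cvg_nsq; apply/funext => n.
by rewrite (psdC P) -dot_iter_adjoint -(psdC P).
Qed.

Lemma asymptotic_qform_cvg x : Q (iter n T x) @[n --> \oo] --> qform asymptotic_form x.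
Proof. exact: cvg_nsq_Re (asymptotic_form_cvg x x). Qed.

Lemma asymptotic_form_psd : psd_form asymptotic_form.
Proof.
have P := dot_psd dot; split => [z a x y|x y|x].
- apply: cvg_nsq_unique (asymptotic_form_cvg _ _) _.
  have := cvg_nsq_lin a (asymptotic_form_cvg x z) (asymptotic_form_cvg y z).
  congr cvg_nsq; apply/funext => n.
  by rewrite iter_linear (psdP P).
- apply: cvg_nsq_unique (asymptotic_form_cvg _ _) _.
  have := cvg_nsq_conj (asymptotic_form_cvg x y).
  by congr cvg_nsq; apply/funext => n; rewrite -(psdC P).
- have c := @asymptotic_qform_cvg x; rewrite -[Re _](cvg_lim _ c)//.
  apply: limr_ge; first by apply/cvg_ex; eexists; exact: c.
  by near=> n; exact: (qform_ge0 P).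
Unshelve. all: by end_near.
Qed.

Lemma asymptotic_formT x y : asymptotic_form (T x) (T y) = asymptotic_form x y.
Proof.
apply: cvg_nsq_unique (asymptotic_form_cvg _ _) _.
have := cvg_nsq_shift (asymptotic_form_cvg x y).
by congr cvg_nsq; apply/funext => n; rewrite !iterSr.
Qed.

Lemma asymptotic_qform_le n x : qform asymptotic_form x <= Q (iter n T x).
Proof.
have c := @asymptotic_qform_cvg x; rewrite -(cvg_lim _ c)//.
apply: limr_le; first by apply/cvg_ex; eexists; exact: c.
by exists n => // m /= nm; exact: iter_contr.
Qed.

End Contraction.

(** Polarisation: sums y + z recover the real parts of the forms, and a factor i in one argument
    recovers the imaginary parts. *)
Lemma asymptotic_limit_eq (R : realType) (H : completeNormedModType R[i])
    (dot : {dot H for (@Num.conj R[i])}) (S T : {linear H -> H}) :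
    hilbert_norm dot ->
    (forall x, qform dot (S x) <= qform dot x) ->
    (forall x, qform dot (T x) <= qform dot x) ->
    (forall x, qform (asymptotic_form dot S) x = qform (asymptotic_form dot T) x) ->
  asymptotic_limit dot S = asymptotic_limit dot T.
Proof.
move=> dot_norm SC TC ST; apply/funext => x.
have PS := asymptotic_form_psd dot_norm SC.
have PT := asymptotic_form_psd dot_norm TC.
have ReE y z : Re (asymptotic_form dot S y z) = Re (asymptotic_form dot T y z).
  have := ST (y + z); rewrite (qformD PS) (qformD PT) !ST; lra.
apply: (dot_injl dot_norm) => y; rewrite -!/(asymptotic_form _ _ _ _).
have := ReE x ('i *: y); rewrite (psdZr PS) (psdZr PT) !ReM ReE.
have := ReE x y.
move: (asymptotic_form _ _ _ _) (asymptotic_form _ _ _ _) => [a b] [c d] /= ->.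
by rewrite !mul0r !add0r !mulN1r !opprK => ->.
Qed.

(** * Complete non-unitarity as an induction principle *)

Section CompletelyNonunitary.
Variables (R : realType) (H : completeNormedModType R[i]).
Variables (dot : {dot H for (@Num.conj R[i])}).
Hypothesis dot_norm : hilbert_norm dot.
Variable T : {linear H -> H}.
Hypothesis T_contr : forall x, qform dot (T x) <= qform dot x.
Hypothesis T_cnu : completely_nonunitary dot T.

Local Notation Q := (qform dot).
Local Notation T' := (adjoint dot T).

(* The orthogonal complement of G reduces T to a unitary operator, because
   T (h - T^* T h) = (1 - T T^* ) (T h). *)
Lemma cnu_induction (G : set H) : closed_subspace G ->
    (forall h, G (h - T (T' h))) ->
    (forall x, G x -> G (T x)) -> (forall x, G (T x) -> G x) ->
  forall x, G x.
Proof.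
move=> Gs GD GT TG; have P := dot_psd dot.
have [_ G0 GL] := Gs.
have adjP := adjointP dot_norm T_contr; have adjPl := adjointPl dot_norm T_contr.
have GB x y : G x -> G y -> G (x - y).
  by move=> Gx Gy; rewrite -[x - y]addrC -scaleN1r; exact: GL.
pose N := [set v | forall x, G x -> dot v x = 0].
have Ns : closed_subspace N.
  split; first 2 last.
  - move=> a x y Nx Ny z Gz.
    by rewrite (psdP P) Nx ?Ny// mulr0 addr0.
  - apply/(closed_qformP dot_norm) => v vN x Gx.
    apply/eqP; rewrite -nsq_eq0 eq_le nsq_ge0 andbT.
    apply/ler_addgt0Pr => e e0; rewrite add0r.
    have Q1 : 0 < Q x + 1 by have := qform_ge0 P x; lra.
    have [y Ny le_y] := vN _ (divr_gt0 e0 Q1).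
    have -> : dot v x = dot (v - y) x.
      by rewrite -scaleN1r (psdDl P) (psdZl P) (Ny _ Gx) mulr0 addr0.
    apply: le_trans (psd_CauchySchwarz P _ _) _.
    apply: (@le_trans _ _ (e / (Q x + 1) * (Q x + 1))); last by rewrite divfK// gt_eqF.
    by apply: ler_pM => //; rewrite ?(qform_ge0 P)// lerDl.
  - by move=> x _; rewrite (psd0l P).
have N1 v : N v -> T (T' v) = v.
  move=> Nv; apply/eqP; rewrite eq_sym -subr_eq0; apply/eqP.
  apply: (dot_injl dot_norm) => x; rewrite (psd0l P).
  have := Nv _ (GD x); rewrite -[- T _]scaleN1r -[- T (T' v)]scaleN1r.
  by rewrite !(psdDl P, psdDr P, psdZl P, psdZr P) rmorphN1 -adjPl -adjP adjP.
have N2 v : N v -> T' (T v) = v.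
  move=> Nv; apply/eqP; rewrite eq_sym -subr_eq0; apply/eqP.
  apply: (dot_injl dot_norm) => x; rewrite (psd0l P).
  have Gx : G (x - T' (T x)) by apply: TG; rewrite linearB; exact: GD.
  have := Nv _ Gx; rewrite -[- T' (T x)]scaleN1r -[- T' (T v)]scaleN1r.
  by rewrite !(psdDl P, psdDr P, psdZl P, psdZr P) rmorphN1 -adjP adjPl.
have NT : reducing dot T N.
  split=> // v Nv; split=> x Gx.
    (* [T (T' x)] is x minus an element of G, hence in G, and [TG] carries this back to [T' x]. *)
    rewrite adjP; apply: Nv; apply: TG.
    by rewrite -[T _](subKr x); apply: GB => //; exact: GD.
  by rewrite adjPl; apply: Nv; exact: GT.
have N0 : N = [set 0] by apply: T_cnu => // v Nv; split; [exact: N2|exact: N1].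
move=> x; have [y Gy yP] := projection_exists dot_norm x Gs.
have : N (x - y) by [].
by rewrite N0 => /= /eqP; rewrite subr_eq0 => /eqP ->.
Qed.

End CompletelyNonunitary.

(** * Power series and the functional calculus *)

Section PowerSeries.
Variable R : realType.
Implicit Types (z w : R[i]) (r e : R).

Definition cabs z : R := Num.sqrt (nsq z).

Lemma cabsE z : `|z| = (cabs z)%:C.
Proof. exact: normcE_nsq. Qed.

Lemma cabs_ge0 z : 0 <= cabs z. Proof. exact: sqrtr_ge0. Qed.

Lemma sqr_cabs z : cabs z ^+ 2 = nsq z.
Proof. by rewrite sqr_sqrtr// nsq_ge0. Qed.

Lemma cabsM z w : cabs (z * w) = cabs z * cabs w.
Proof. by apply: (@complexI R); rewrite rmorphM/= -!cabsE normrM. Qed.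

Lemma cabsD_le z w : cabs (z + w) <= cabs z + cabs w.
Proof. by rewrite -lecR rmorphD/= -!cabsE ler_normD. Qed.

Lemma cabsX z n : cabs (z ^+ n) = cabs z ^+ n.
Proof. by apply: (@complexI R); rewrite rmorphXn/= -!cabsE normrX. Qed.

Lemma cabs0 : cabs 0 = 0. Proof. by rewrite /cabs nsq0 sqrtr0. Qed.

Lemma cabsN z : cabs (- z) = cabs z. Proof. by rewrite /cabs nsqN. Qed.

Lemma cabs_real r : 0 <= r -> cabs r%:C = r.
Proof. by move=> r0; rewrite /cabs nsq_real sqrtr_sqr ger0_norm. Qed.

Lemma cabs_sum_le n (F : nat -> R[i]) :
  cabs (\sum_(i < n) F i) <= \sum_(i < n) cabs (F i).
Proof.
elim: n => [|n IH]; first by rewrite !big_ord0 cabs0.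
by rewrite !big_ord_recr; apply: le_trans (cabsD_le _ _) _; rewrite lerD2r.
Qed.

Lemma nsq_le_cabs z e : 0 <= e -> (nsq z <= e ^+ 2) = (cabs z <= e).
Proof. by move=> e0; rewrite -sqr_cabs ler_pXn2r// nnegrE cabs_ge0. Qed.

Lemma cabs1_nsq z : nsq z = 1 -> cabs z = 1.
Proof. by rewrite /cabs => ->; rewrite sqrtr1. Qed.

Lemma discE z : disc z <-> cabs z < 1.
Proof. by rewrite /disc/= cabsE -[1 in X in X <-> _]/(1%:C) ltcR. Qed.

Lemma disc_scale r z : 0 <= r < 1 -> cabs z <= 1 -> disc (r%:C * z).
Proof.
move=> /andP[r0 r1] z1; apply/discE; rewrite cabsM cabs_real//.
by apply: le_lt_trans r1; rewrite ler_piMr.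
Qed.

Lemma cvgC_cabs (f : nat -> R[i]) (l : R[i]) :
  (f n : R[i]^o) @[n --> \oo] --> (l : R[i]^o) ->
  forall e, 0 < e -> exists N, forall n, (N <= n)%N -> cabs (l - f n) <= e.
Proof.
move=> /cvgrPdist_le fl e e0; have eC : 0 < e%:C by rewrite ltcR.
have [N _ NP] := fl _ eC; exists N => n /NP.
by rewrite cabsE lecR.
Qed.

Lemma geometric_tail_le (q : R) N m : 0 <= q < 1 ->
  \sum_(i < m) q ^+ (N + i) <= q ^+ N / (1 - q).
Proof.
move=> /andP[q0 q1]; have q1' : 0 < 1 - q by rewrite subr_gt0.
rewrite ler_pdivlMr// mulr_suml.
suff -> : \sum_(i < m) q ^+ (N + i) * (1 - q) = q ^+ N - q ^+ (N + m).
  by rewrite gerBl exprn_ge0.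
elim: m => [|m IH]; first by rewrite big_ord0 addn0 subrr.
by rewrite big_ord_recr IH/= addnS exprS; ring.
Qed.

Variables (u : R[i] -> R[i]) (c : nat -> R[i]).
Hypothesis uc : disc_expansion u c.

(** A Taylor polynomial of z -> u(rz). *)
Definition psum r N : {poly R[i]} := \poly_(i < N) (c i * r%:C ^+ i).

(** The series converges at some rho with r < rho < 1, so its terms there are bounded, and the ratio
    r / rho does the rest. *)
Lemma coef_geometric r : 0 <= r < 1 ->
  exists K q, [/\ 0 <= K, 0 <= q < 1 & forall n, cabs (c n) * r ^+ n <= K * q ^+ n].
Proof.
move=> /andP[r0 r1]; pose rho := (1 + r) / 2.
have rho0 : 0 < rho by rewrite /rho; lra.
have rho1 : rho < 1 by rewrite /rho; lra.
have rrho : r < rho by rewrite /rho; lra.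
have drho : disc rho%:C by apply/discE; rewrite cabs_real// ltW.
have /cvgC_cabs : (c n * rho%:C ^+ n : R[i]^o) @[n --> \oo] --> (0 : R[i]^o).
  by apply: cvg_series_cvg_0; apply/cvg_ex; exists (u rho%:C); exact: uc.
move=> /(_ 1 ltr01)[N NP].
pose a n := cabs (c n) * rho ^+ n.
have aE n : cabs (c n * rho%:C ^+ n) = a n.
  by rewrite cabsM cabsX cabs_real// ltW.
have a0 n : 0 <= a n by rewrite mulr_ge0 ?cabs_ge0// exprn_ge0// ltW.
(* The sum dominates each of the first N terms, and 1 dominates the later ones. *)
exists (1 + \sum_(i < N) a i), (r / rho); split.
- by rewrite addr_ge0// sumr_ge0.
- by rewrite divr_ge0 ?(ltW rho0)//= ltr_pdivrMr// mul1r.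
- move=> n; have -> : cabs (c n) * r ^+ n = a n * (r / rho) ^+ n.
    by rewrite /a -[RHS]mulrA -exprMn mulrCA divff ?gt_eqF// mulr1.
  apply: ler_wpM2r; first by rewrite exprn_ge0// divr_ge0// ltW.
  have [nN|Nn] := ltnP n N.
    rewrite (bigD1 (Ordinal nN))//= addrCA lerDl addr_ge0// sumr_ge0//.
  have := NP _ Nn; rewrite sub0r cabsN aE => an1.
  by apply: le_trans an1 _; rewrite lerDl sumr_ge0.
Qed.

Lemma psum_tail r e : 0 <= r < 1 -> 0 < e -> exists N0, forall N m z,
  (N0 <= N)%N -> (N <= m)%N -> cabs z <= 1 ->
  cabs ((psum r m).[z] - (psum r N).[z]) <= e.
Proof.
move=> r01 e0; have [K [q [K0 q01 cKq]]] := coef_geometric r01.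
have /andP[r0 r1] := r01; have /andP[q0 q1] := q01.
have q1' : 0 < 1 - q by rewrite subr_gt0.
have : K * q ^+ n / (1 - q) @[n --> \oo] --> (0 : R).
  rewrite -[X in _ --> X](mul0r (1 - q)^-1) -[X in X * _](mulr0 K).
  apply: cvgM; last exact: cvg_cst.
  by apply: cvgM; [exact: cvg_cst|apply: cvg_expr; rewrite ger0_norm].
move=> /cvgrPdist_le/(_ e e0)[N0 _ NP]; exists N0 => N m z N0N Nm z1.
rewrite !horner_poly -(subnKC Nm) big_split_ord/= addrAC subrr add0r.
apply: le_trans (cabs_sum_le _ (fun i => c (N + i)%N * r%:C ^+ (N + i) * z ^+ (N + i))) _.
apply: (@le_trans _ _ (\sum_(i < m - N) K * q ^+ (N + i))).
  apply: ler_sum => i _; rewrite !cabsM !cabsX cabs_real//.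
  apply: le_trans (cKq _); rewrite ler_piMr//.
    by rewrite mulr_ge0 ?cabs_ge0// exprn_ge0.
  by rewrite exprn_ile1// cabs_ge0.
rewrite -mulr_sumr; apply: le_trans (ler_wpM2l K0 (geometric_tail_le N _ q01)) _.
have := NP N N0N; rewrite /= sub0r normrN mulrA => le_e.
exact: le_trans (ler_norm _) le_e.
Qed.

Lemma psum_approx r e : 0 <= r < 1 -> 0 < e -> exists N0, forall N z,
  (N0 <= N)%N -> cabs z <= 1 -> cabs (u (r%:C * z) - (psum r N).[z]) <= e.
Proof.
move=> r01 e0; have e2 : 0 < e / 2 by lra.
have [N0 NP] := psum_tail r01 e2; exists N0 => N z N0N z1.
have /cvgC_cabs/(_ _ e2)[N1 N1P] := uc (disc_scale r01 z1).
have := N1P _ (leq_maxl N1 N).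
rewrite (_ : \sum_(0 <= k < _) _ = (psum r (maxn N1 N)).[z]); last first.
  rewrite big_mkord horner_poly; apply: eq_bigr => i _.
  by rewrite /= exprMn mulrA.
have := NP _ _ z N0N (leq_maxr N1 N) z1.
move: (psum r (maxn N1 N)).[z] => w h1 h2.
have -> : u (r%:C * z) - (psum r N).[z] =
    (u (r%:C * z) - w) + (w - (psum r N).[z]) by rewrite addrA subrK.
apply: le_trans (cabsD_le _ _) _; lra.
Qed.

End PowerSeries.

(** * Smallness of p(T)x for a completely non-unitary T *)

Section PolyopSmall.
Variables (R : realType) (H : completeNormedModType R[i]).
Variables (dot : {dot H for (@Num.conj R[i])}).
Hypothesis dot_norm : hilbert_norm dot.
Variable T : {linear H -> H}.
Hypothesis T_contr : forall x, qform dot (T x) <= qform dot x.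

Local Notation Q := (qform dot).
Local Notation T' := (adjoint dot T).

(* Dual to the estimate of the defect of T: the vector p(T)(1 - T T^* )h is
   tested against itself. *)
Lemma polyop_codefect_le (p : {poly R[i]}) h :
  Q (polyop T p (h - T (T' h))) <= (\sum_(i < size p) nsq p`_i) * Q h.
Proof.
have P := dot_psd dot.
pose Ta : {linear H -> H} :=
  HB.pack T' (GRing.isLinear.Build _ _ _ _ T' (adjoint_linear dot_norm T_contr)).
have Ta_contr x : Q (Ta x) <= Q x := adjoint_contr dot_norm T_contr x.
have P' := psd_defect P Ta_contr; set s := defect_form dot Ta in P'.
set w := polyop T p _; set S := \sum_(i < size p) _.
have S0 : 0 <= S by apply: sumr_ge0 => i _; exact: nsq_ge0.
pose v := \sum_(i < size p) (p`_i)^* *: iter i Ta w.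
(* h - T T' h pairs with y as h does with y in the defect form of T', so moving p(T) across the
   product leaves [s h v]. *)
have wv : dot w w = s h v.
  rewrite {1}/w /polyop (psd_suml P) (psd_sumr P'); apply: eq_bigr => i _.
  rewrite (psdZl P) (psdZr P') conjCK; congr (_ * _).
  rewrite (dot_iter_adjoint dot_norm T_contr) /s /defect_form -scaleN1r (psdDl P) (psdZl P).
  by rewrite mulN1r (adjointP dot_norm T_contr).
have Qv : qform s v <= S * Q w.
  apply: le_trans (qform_sum_le P' _ (fun i => (p`_i)^*) (fun i => iter i Ta w)) _.
  under eq_bigr do rewrite nsq_conj.
  by rewrite sum_qform_defect ler_wpM2l// gerBl (qform_ge0 P).
have Qh : qform s h <= Q h by rewrite qform_defect gerBl (qform_ge0 P).
have := Re_psd_le P' Qh Qv; rewrite -wv -/(qform dot w).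
have [->|Qw0] := eqVneq (Q w) 0; first by move=> _; rewrite mulr_ge0 ?(qform_ge0 P).
have Qw : 0 < Q w by rewrite lt_def Qw0 (qform_ge0 P).
by rewrite expr2 mulrA ler_pM2r// mulrC.
Qed.

Hypothesis T_cnu : completely_nonunitary dot T.

(** By [cnu_induction]: the von Neumann inequality makes the set of such x closed,
    [polyop_codefect_le] puts each h - T T' h in it, and [defect_polyop_le] leads from T x back to
    x. *)
Theorem cnu_polyop_small x (M e : R) : 0 < e -> exists2 d : R, 0 < d &
  forall p : {poly R[i]}, (forall z, nsq z = 1 -> nsq p.[z] <= M) ->
    \sum_(i < size p) nsq p`_i <= d -> Q (polyop T p x) <= e.
Proof.
have P := dot_psd dot; have Q0 := qform_ge0 P.
pose G := [set x | forall M e : R, 0 < e -> exists2 d : R, 0 < d &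
  forall p : {poly R[i]}, (forall z, nsq z = 1 -> nsq p.[z] <= M) ->
    \sum_(i < size p) nsq p`_i <= d -> Q (polyop T p x) <= e].
suff /(_ x) : forall x, G x by apply.
have divE (A k : R) : 0 < A -> 0 <= k -> k * (A / (k + 1)) <= A.
  by move=> A0 k0; rewrite mulrCA ler_piMr ?(ltW A0)// ler_pdivrMr ?mul1r; lra.
apply: (cnu_induction dot_norm T_contr T_cnu) => {x M e}.
- split.
  + apply/(closed_qformP dot_norm) => x xG M e e0.
    pose M' := `|M|; have M'0 : 0 <= M' := normr_ge0 M.
    have d0 : 0 < (e / 4) / (M' + 1) by rewrite divr_gt0; lra.
    have [y Gy le_y] := xG _ d0.
    have e4 : 0 < e / 4 by lra.
    have [d d1 dP] := Gy M _ e4; exists d => // p pM pd.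
    apply: le_trans (qform_le P _ (polyop T p y)) _.
    have -> : polyop T p x - polyop T p y = polyop T p (x - y).
      by rewrite -scaleN1r addrC -polyop_linear scaleN1r addrC.
    have := dP p pM pd; suff : Q (polyop T p (x - y)) <= e / 4 by lra.
    apply: le_trans (von_neumann P _ T_contr pM) _.
    apply: (@le_trans _ _ (M' * Q (x - y))); first by rewrite ler_wpM2r ?ler_norm.
    by apply: le_trans (ler_wpM2l M'0 le_y) _; apply: divE.
  + move=> M e e0; exists 1 => // p _ _.
    suff -> : polyop T p 0 = 0 by rewrite (qform0 P) ltW.
    by have := polyop_linear T p (-1) 0 0; rewrite scaler0 addr0 scaleN1r addNr.
  + move=> a x y Gx Gy M e e0.
    have a1 : 0 < nsq a + 1 by have := nsq_ge0 a; lra.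
    have e4 : 0 < e / 4 by lra.
    have [d1 d10 d1P] := Gx M _ (divr_gt0 e4 a1).
    have [d2 d20 d2P] := Gy M _ e4.
    exists (Num.min d1 d2); first by rewrite lt_min d10.
    move=> p pM; rewrite le_min => /andP[pd1 pd2].
    rewrite polyop_linear; apply: le_trans (qformD_le P _ _) _.
    rewrite (qformZ P); have := d2P p pM pd2; have := d1P p pM pd1 => le1 le2.
    suff : nsq a * Q (polyop T p x) <= e / 4 by lra.
    by apply: le_trans (ler_wpM2l (nsq_ge0 a) le1) _; apply: divE => //; exact: nsq_ge0.
- move=> h M e e0; have Q1 : 0 < Q h + 1 by have := Q0 h; lra.
  exists (e / (Q h + 1)); first exact: divr_gt0.
  move=> p _ pd; apply: le_trans (polyop_codefect_le p h) _.
  by apply: le_trans (ler_wpM2r (Q0 h) pd) _; rewrite mulrC; apply: divE.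
- move=> x Gx M e e0; have [d d0 dP] := Gx M e e0; exists d => // p pM pd.
  rewrite polyop_comm//; apply: le_trans (T_contr _) _; exact: dP.
- move=> x Gx M e e0; have e2 : 0 < e / 2 by lra.
  have [d d0 dP] := Gx M _ e2.
  have Q1 : 0 < Q x + 1 by have := Q0 x; lra.
  exists (Num.min d (e / 2 / (Q x + 1))); first by rewrite lt_min d0 divr_gt0.
  move=> p pM; rewrite le_min => /andP[pd1 pd2].
  have := dP p pM pd1; rewrite polyop_comm// => le1.
  have := defect_polyop_le P p x T_contr.
  have : (\sum_(i < size p) nsq p`_i) * Q x <= e / 2.
    by apply: le_trans (ler_wpM2r (Q0 x) pd2) _; rewrite mulrC; apply: divE.
  lra.
Qed.

End PolyopSmall.

(** * Polynomial approximants of u(rz) along radii tending to 1 *)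

Section Approximants.
Variables (R : realType) (u : R[i] -> R[i]) (c : nat -> R[i]).
Hypothesis uc : disc_expansion u c.

(** Starting at 1/2 keeps every radius positive, so that [inner_le1] can divide by it. *)
Definition radius (k : nat) : R := 1 - k.+2%:R^-1.

Lemma radius_itv k : 0 <= radius k < 1.
Proof.
rewrite subr_ge0 invf_le1 ?ltr0n// ler1n/=.
by rewrite gtrBl invr_gt0 ltr0n.
Qed.

Lemma cvg_radius1 : radius k @[k --> \oo] --> (1 : R).
Proof.
rewrite -[X in _ --> X]subr0; apply: cvgB; first exact: cvg_cst.
by have := @cvg_harmonic R; rewrite -(cvg_shiftS (harmonic : R ^nat)).
Qed.

Lemma cvg_radius : radius k @[k --> \oo] --> (1 : R)^'-.
Proof.
have r1 := cvg_radius1; move=> A /= A1.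
have : \forall k \near \oo, radius k < 1 -> A (radius k) by exact: (r1 _ A1).
apply: filterS => k; apply; by have /andP[] := radius_itv k.
Qed.

Lemma ler_sum_ord (F : nat -> R) n m : (n <= m)%N -> (forall i, 0 <= F i) ->
  \sum_(i < n) F i <= \sum_(i < m) F i.
Proof.
by move=> nm F0; rewrite -(subnKC nm) big_split_ord/= lerDl sumr_ge0.
Qed.

Lemma sum_nsq_coef (p : {poly R[i]}) n : (size p <= n)%N ->
  \sum_(i < size p) nsq p`_i = \sum_(i < n) nsq p`_i.
Proof.
move=> pn; rewrite -(subnKC pn) big_split_ord/= [X in _ = _ + X]big1 ?addr0// => i _.
by rewrite nth_default ?nsq0// leq_addr.
Qed.

Lemma psum_sub_nsq r s n :
  \sum_(i < size (psum c r n - psum c s n)) nsq (psum c r n - psum c s n)`_i =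
  \sum_(i < n) nsq (c i) * (r ^+ i - s ^+ i) ^+ 2.
Proof.
rewrite (@sum_nsq_coef _ n); last first.
  apply: leq_trans (size_polyD _ _) _; rewrite size_polyN geq_max.
  by apply/andP; split; exact: size_poly.
apply: eq_bigr => i _.
have coefE (a : R) : (psum c a n)`_i = c i * a%:C ^+ i by rewrite coef_poly ltn_ord.
rewrite coefB !coefE -mulrBr nsqM; congr (_ * _).
by rewrite -!rmorphXn -rmorphB nsq_real.
Qed.

(** The last clause controls the tail of the series of u(rT). The condition k < n keeps the constant
    term and lets every index be covered eventually. *)
Definition approximates (k n : nat) := [/\ (k < n)%N,
  forall z, cabs z <= 1 ->
    cabs (u ((radius k)%:C * z) - (psum c (radius k) n).[z]) <= k.+1%:R^-1 &
  forall m z, (n <= m)%N -> cabs z <= 1 ->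
    cabs ((psum c (radius k) m).[z] - (psum c (radius k) n).[z]) <= k.+1%:R^-1].

Lemma approximant_exists : exists N, forall k, approximates k (N k).
Proof.
suff /choice[N NP] : forall k, exists n, approximates k n by exists N.
move=> k.
have k0 : 0 < k.+1%:R^-1 :> R by rewrite invr_gt0 ltr0n.
have [N1 P1] := psum_approx uc (radius_itv k) k0.
have [N2 P2] := psum_tail uc (radius_itv k) k0.
exists (maxn k.+1 (maxn N1 N2)); split; first exact: leq_maxl.
  by move=> z; apply: P1; rewrite !leq_max leqnn orbT.
by move=> m z Nm; apply: P2 => //; rewrite !leq_max leqnn !orbT.
Qed.

End Approximants.

(** * Existence, linearity and commutation of u(T) *)

Section Calculus.
Variables (R : realType) (H : completeNormedModType R[i]).
Variables (dot : {dot H for (@Num.conj R[i])}).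
Hypothesis dot_norm : hilbert_norm dot.
Variable T : {linear H -> H}.
Hypothesis T_contr : forall x, qform dot (T x) <= qform dot x.
Hypothesis T_cnu : completely_nonunitary dot T.
Variable u : R[i] -> R[i].
Local Notation c := (taylor_coef u).
Hypothesis uc : disc_expansion u c.
Hypothesis u_le1 : forall z, disc z -> cabs (u z) <= 1.
Hypothesis c_le1 : forall N, \sum_(i < N) nsq (c i) <= 1.

Local Notation Q := (qform dot).
Local Notation U r := (calculus_scaled u r T).
Implicit Types (r : R) (x : H).

Lemma psum_le2 r : 0 <= r < 1 -> exists N0, forall N, (N0 <= N)%N ->
  forall z, cabs z <= 1 -> cabs (psum c r N).[z] <= 2.
Proof.
move=> r01; have [N0 NP] := psum_approx uc r01 ltr01.
exists N0 => N N0N z z1.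
have -> : (psum c r N).[z] = u (r%:C * z) + - (u (r%:C * z) - (psum c r N).[z]).
  by rewrite opprB addrC subrK.
apply: le_trans (cabsD_le _ _) _; rewrite cabsN.
have := NP _ _ N0N z1; have := u_le1 (disc_scale r01 z1); lra.
Qed.

Lemma polyop_diff_le (p q : {poly R[i]}) (e : R) x : 0 <= e ->
  (forall z, cabs z <= 1 -> cabs (p.[z] - q.[z]) <= e) ->
  Q (polyop T p x - polyop T q x) <= e ^+ 2 * Q x.
Proof.
move=> e0 pq; rewrite -polyopB; apply: (von_neumann (dot_psd dot)) => // z z1.
by rewrite hornerD hornerN nsq_le_cabs// pq// cabs1_nsq.
Qed.

Lemma calculus_scaled_cvg r x : 0 <= r < 1 ->
  polyop T (psum c r N) x @[N --> \oo] --> U r x.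
Proof.
move=> r01; rewrite /calculus_scaled.
have -> : [series (c n * r%:C ^+ n) *: iter n T x]_n =
    (fun N => polyop T (psum c r N) x).
  by apply/funext => N; rewrite /psum polyop_poly /series/= big_mkord.
apply: (qform_cauchy dot_norm) => e e0.
have Q1 : 0 < Q x + 1 by have := qform_ge0 (dot_psd dot) x; lra.
have d0 : 0 < Num.sqrt (e / (Q x + 1)) by rewrite sqrtr_gt0 divr_gt0.
have [N0 NP] := psum_tail uc r01 d0.
exists N0; exists N0 => // m /= N0m.
apply: le_trans (polyop_diff_le _ (ltW d0) (fun z => NP _ _ z (leqnn N0) N0m)) _.
rewrite sqr_sqrtr ?divr_ge0 ?(ltW e0) ?(ltW Q1)// mulrC mulrCA ler_piMr ?(ltW e0)//.
by rewrite ler_pdivrMr// mul1r lerDl.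
Qed.

Lemma calculus_scaled_approx r (e : R) N x : 0 <= r < 1 -> 0 <= e ->
    (forall m z, (N <= m)%N -> cabs z <= 1 ->
       cabs ((psum c r m).[z] - (psum c r N).[z]) <= e) ->
  Q (U r x - polyop T (psum c r N) x) <= 2 * e ^+ 2 * Q x.
Proof.
move=> r01 e0 NP; have P := dot_psd dot; apply/ler_addgt0Pr => d d0.
have d2 : 0 < d / 2 by lra.
have [m mP] := (cvg_qform_seq dot_norm _ _).1 (@calculus_scaled_cvg _ x r01) _ d2.
have := mP _ (leq_maxl m N).
have := polyop_diff_le x e0 (fun z => NP _ z (leq_maxr m N)).
move: (polyop T (psum c r (maxn m N)) x) => y h1 h2.
have -> : U r x - polyop T (psum c r N) x =
   - (y - U r x) + (y - polyop T (psum c r N) x).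
  by rewrite opprB addrA subrK.
by apply: le_trans (qformD_le P _ _) _; rewrite (qformN P); lra.
Qed.

(** Taylor polynomials for radii r and r0 near 1 differ by a polynomial bounded on the circle whose
    coefficients have small l^2 norm, so [cnu_polyop_small] gives the Cauchy property. *)
Lemma calculus_cvg x : U r x @[r --> (1 : R)^'-] --> calculus u T x.
Proof.
have P := dot_psd dot; have Q0 := qform_ge0 P x.
suff : cvg (U r x @[r --> (1 : R)^'-]) by [].
apply: (qform_cauchy dot_norm) => e e0.
(* [qform_triangle4] has weights 2, 4 and 4, so e/16 for each of the three distances suffices. *)
have e8 : 0 < e / 16 by lra.
have le_sum (a b d' : R) : a <= e / 16 -> b <= e / 16 -> d' <= e / 16 ->
  2 * a + 4 * b + 4 * d' <= e by lra.
(* 16 = (2 + 2)^2: both Taylor polynomials are at most 2 in modulus. *)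
have [d d0 dP] := cnu_polyop_small dot_norm T_contr T_cnu x 16 e8.
have d2 : 0 < d / 2 by lra.
have [N1 N1P] : exists N1, forall N, (N1 <= N)%N ->
    \sum_(i < N - N1) nsq (c (N1 + i)%N) <= d / 2.
  pose s N := \sum_(i < N) nsq (c i).
  have sS m n : (m <= n)%N -> s n = s m + \sum_(i < n - m) nsq (c (m + i)%N).
    by move=> mn; rewrite {1}/s -(subnKC mn) big_split_ord/= addKn.
  have : cvg (s N @[N --> \oo]).
    apply: nondecreasing_is_cvgn.
      by move=> m n mn; rewrite (sS _ _ mn) lerDl sumr_ge0// => i _; exact: nsq_ge0.
    by exists 1 => _ [N _ <-]; exact: c_le1.
  move=> /cvgrPdist_le/(_ (d / 4) (divr_gt0 d0 (ltr0n _ 4)))[N1 _ NP].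
  exists N1 => N N1N; have := NP _ N1N; have := NP _ (leqnn N1).
  rewrite !ler_distl (sS _ _ N1N); set t := \sum_(i < _) _; lra.
(* [N1] makes the tail of the squared coefficients small; [r0] near 1 handles the finitely many
   others. *)
have [r0 /andP[r00 r01] r0P] : exists2 r0 : R, 0 <= r0 < 1 &
    \sum_(i < N1) nsq (c i) * (1 - r0 ^+ i) ^+ 2 <= d / 2.
  pose f : {poly R} := \sum_(i < N1) (nsq (c i))%:P * (1 - 'X^i) ^+ 2.
  have fE r : f.[r] = \sum_(i < N1) nsq (c i) * (1 - r ^+ i) ^+ 2.
    by rewrite /f horner_sum; apply: eq_bigr => i _; rewrite !hornerE.
  have f1 : f.[1] = 0.
    by rewrite fE big1// => i _; rewrite expr1n subrr expr0n mulr0.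
  have : f.[r] @[r --> (1 : R)^'-] --> f.[1].
    by apply: cvg_at_left_filter; exact: continuous_horner.
  rewrite f1 => /cvgrPdist_le/(_ _ d2) fr.
  have : \forall r \near (1:R)^'-, 0 <= r < 1 /\ f.[r] <= d / 2.
    near=> r; split.
      by apply/andP; split; near: r; [exact: nbhs_left_ge|exact: nbhs_left_lt].
    apply: le_trans (ler_norm _) _; rewrite -normrN -sub0r.
    by near: r; exact: fr.
  by case/filter_ex => r [r01 fr2]; exists r; rewrite // -fE.
exists r0; near=> r.
have rr0 : r0 <= r by near: r; exact: nbhs_left_ge.
have r1 : r < 1 by near: r; exact: nbhs_left_lt.
have r_itv : 0 <= r < 1 by rewrite r1 (le_trans r00).
have r0_itv : 0 <= r0 < 1 by rewrite r00.
have k0 : 0 < Num.sqrt (e / 32 / (Q x + 1)).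
  by rewrite sqrtr_gt0 !divr_gt0//; lra.
have [M1 M1P] := psum_tail uc r_itv k0.
have [M2 M2P] := psum_tail uc r0_itv k0.
have [M3 M3P] := psum_le2 r_itv.
have [M4 M4P] := psum_le2 r0_itv.
pose N := maxn N1 (maxn (maxn M1 M2) (maxn M3 M4)).
have N1N : (N1 <= N)%N by rewrite leq_max leqnn.
have M1N : (M1 <= N)%N by rewrite !leq_max leqnn ?orbT.
have M2N : (M2 <= N)%N by rewrite !leq_max leqnn ?orbT.
have M3N : (M3 <= N)%N by rewrite !leq_max leqnn ?orbT.
have M4N : (M4 <= N)%N by rewrite !leq_max leqnn ?orbT.
have := calculus_scaled_approx x r_itv (ltW k0) (fun m z => M1P N m z M1N).
have := calculus_scaled_approx x r0_itv (ltW k0) (fun m z => M2P N m z M2N).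
have -> : 2 * Num.sqrt (e / 32 / (Q x + 1)) ^+ 2 * Q x = (Q x / (Q x + 1)) * (e / 16).
  rewrite sqr_sqrtr; last by rewrite !divr_ge0//; lra.
  field; lra.
have le_e : Q x / (Q x + 1) * (e / 16) <= e / 16.
  by rewrite ler_piMl ?(ltW e8)// ler_pdivrMr ?mul1r; lra.
move=> /le_trans/(_ le_e) h0 /le_trans/(_ le_e) h1.
suff h2 : Q (polyop T (psum c r N) x - polyop T (psum c r0 N) x) <= e / 16.
  by apply: le_trans (qform_triangle4 P _ _ _ _) _; apply: le_sum h1 h2 h0.
rewrite -polyopB; set p := psum c r N - psum c r0 N; apply: dP => [z /cabs1_nsq z1|].
  rewrite (_ : 16 = 4 ^+ 2); last by ring.
  rewrite nsq_le_cabs// hornerD hornerN; apply: le_trans (cabsD_le _ _) _.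
  rewrite cabsN (_ : 4 = 2 + 2); last by ring.
  by apply: lerD; [apply: M3P|apply: M4P]; rewrite ?z1.
rewrite psum_sub_nsq.
(* For r >= r0 the head is thus bounded as for [r0] against 1, and in the tail the factor is at most
   1. *)
have rB i : 0 <= r ^+ i - r0 ^+ i <= 1 - r0 ^+ i.
  rewrite subr_ge0 lerD2r lerXn2r ?nnegrE//; last by rewrite (le_trans r00).
  by rewrite exprn_ile1 ?(ltW r1)// (le_trans r00).
have r0i i : 0 <= 1 - r0 ^+ i <= 1.
  by rewrite subr_ge0 exprn_ile1 ?(ltW r01)//= gerBl exprn_ge0.
rewrite -(subnKC N1N) big_split_ord/=.
rewrite [leRHS](splitr d).
apply: lerD.
  apply: le_trans r0P; apply: ler_sum => i _; apply: ler_wpM2l; first exact: nsq_ge0.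
  by have /andP[a b] := rB i; rewrite ler_pXn2r ?nnegrE//; exact: le_trans b.
apply: le_trans (N1P _ N1N); apply: ler_sum => i _.
rewrite ler_piMr ?nsq_ge0// exprn_ile1//; have /andP[a b] := rB (N1 + i)%N => //.
by apply: le_trans b _; have /andP[] := r0i (N1 + i)%N.
Unshelve. all: by end_near.
Qed.

Variable N : nat -> nat.
Hypothesis N_approx : forall k, approximates u c k (N k).
Local Notation p k := (psum c (radius R k) (N k)).

(** Replaces the two nested limits that define u(T) by one sequence of polynomials, which the later
    limit arguments use. *)
Lemma calculus_approx x : polyop T (p k) x @[k --> \oo] --> calculus u T x.
Proof.
have P := dot_psd dot; apply/(cvg_qform_seq dot_norm) => e e0.
have Q0 := qform_ge0 P x.
have Uk : U (radius R k) x @[k --> \oo] --> calculus u T x.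
  exact: (cvg_comp _ _ (@cvg_radius R) (@calculus_cvg x)).
have [k1 k1P] := (cvg_qform_seq dot_norm _ _).1 Uk _ (divr_gt0 e0 (ltr0n _ 4)).
have d0 : 0 < e / 8 / (Q x + 1) by rewrite !divr_gt0//; lra.
have [k2 k2P] := inv_nat_small d0.
exists (maxn k1 k2) => k; rewrite geq_max => /andP[/k1P le1 /k2P le2].
have [_ _ Np] := N_approx k.
have k0 : 0 <= k.+1%:R^-1 :> R by rewrite invr_ge0.
have := calculus_scaled_approx x (radius_itv R k) k0 Np.
have k1' : k.+1%:R^-1 <= 1 :> R by rewrite invf_le1 ?ler1n ?ltr0n.
have : k.+1%:R^-1 ^+ 2 * Q x <= e / 8.
  apply: (@le_trans _ _ (e / 8 / (Q x + 1) * Q x)).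
    by rewrite ler_wpM2r// expr2; apply: le_trans le2; rewrite ler_piMl.
  by rewrite mulrC mulrCA ler_piMr ?ler_pdivrMr ?mul1r; lra.
move: (U (radius R k) x) le1 => y le1 le3 le4.
have -> : polyop T (p k) x - calculus u T x =
    - (y - polyop T (p k) x) + (y - calculus u T x).
  by rewrite opprB addrA subrK.
apply: le_trans (qformD_le P _ _) _; rewrite (qformN P).
move: le4; rewrite -[2 * _ * Q x]mulrA.
move: le1 le3; move: (Q (y - _)) (Q (y - _)) (_ ^+ 2 * Q x) => q1 q2 q3.
lra.
Qed.

Lemma approximant_le k z : cabs z <= 1 -> cabs (p k).[z] <= 1 + k.+1%:R^-1.
Proof.
move=> z1; have [_ Np _] := N_approx k; have := Np z z1.
have := u_le1 (disc_scale (radius_itv R k) z1).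
move: (u _) => w w1 h.
have -> : (p k).[z] = w + - (w - (p k).[z]) by rewrite opprB addrC subrK.
by apply: le_trans (cabsD_le _ _) _; rewrite cabsN lerD.
Qed.

Lemma calculus_linear : linear (calculus u T).
Proof.
move=> a x y.
have c1 := @calculus_approx (a *: x + y).
have c2 : polyop T (p k) (a *: x + y) @[k --> \oo] -->
    a *: calculus u T x + calculus u T y.
  have -> : (fun k => polyop T (p k) (a *: x + y)) =
    (fun k => a *: polyop T (p k) x + polyop T (p k) y).
    by apply/funext => k; rewrite polyop_linear.
  apply: cvgD; last exact: calculus_approx.
  by apply: cvgZ; [exact: cvg_cst|exact: calculus_approx].
exact: (cvg_unique _ c1 c2).
Qed.

Lemma calculus_comm x : calculus u T (T x) = T (calculus u T x).
Proof.
have c1 := @calculus_approx (T x).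
have c2 : polyop T (p k) (T x) @[k --> \oo] --> T (calculus u T x).
  apply/(cvg_qform_seq dot_norm) => e e0.
  have [k kP] := (cvg_qform_seq dot_norm _ _).1 (@calculus_approx x) _ e0.
  exists k => n /kP le_n; rewrite polyop_comm// -linearB.
  exact: le_trans (T_contr _) le_n.
exact: (cvg_unique _ c1 c2).
Qed.

End Calculus.

(** * Inner functions *)

Section CircleIntegral.
Variable R : realType.
Implicit Types (p q : {poly R[i]}) (t : R).

Lemma nsq_expi t : nsq (expi t) = 1.
Proof. exact: cos2Dsin2. Qed.

Lemma cabs_expi t : cabs (expi t) = 1.
Proof. exact: cabs1_nsq (nsq_expi t). Qed.

Lemma is_derive_horner_expi p t :
  is_derive t 1 (fun t => Re p.[expi t]) (Re ('i * expi t * p^`().[expi t])) /\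
  is_derive t 1 (fun t => Im p.[expi t]) (Im ('i * expi t * p^`().[expi t])).
Proof.
elim/poly_ind: p => [|p a [IHr IHi]].
  rewrite deriv0 !horner0 mulr0; split.
    rewrite (_ : (fun s => Re 0.[expi s]) = cst 0); first exact: is_derive_cst.
    by apply/funext => s; rewrite horner0.
  rewrite (_ : (fun s => Im 0.[expi s]) = cst 0); first exact: is_derive_cst.
  by apply/funext => s; rewrite horner0.
have -> : (fun s => Re (p * 'X + a%:P).[expi s]) =
    (fun s => Re p.[expi s]) * cos - (fun s => Im p.[expi s]) * sin + cst (Re a).
  by apply/funext => s; rewrite hornerMXaddC ReD ReM/= !fctE.
have -> : (fun s => Im (p * 'X + a%:P).[expi s]) =
    (fun s => Re p.[expi s]) * sin + (fun s => Im p.[expi s]) * cos + cst (Im a).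
  by apply/funext => s; rewrite hornerMXaddC ImD ImM/= !fctE.
have -> : (p * 'X + a%:P)^`() = p^`() * 'X + p by rewrite derivMXaddC addrC.
move: IHr IHi; rewrite hornerD hornerMX !(ReM, ImM, ReD, ImD) /=.
move=> IHr IHi; split.
  apply: (is_derive_eq (is_deriveD (is_deriveB (is_deriveM IHr (is_derive_cos t))
    (is_deriveM IHi (is_derive_sin t))) (is_derive_cst _ _ _))).
  rewrite /GRing.scale/=.
  move: (Re p.[_]) (Im p.[_]) (Re p^`().[_]) (Im p^`().[_]) (cos t) (sin t).
  by move=> *; ring.
apply: (is_derive_eq (is_deriveD (is_deriveD (is_deriveM IHr (is_derive_sin t))
  (is_deriveM IHi (is_derive_cos t))) (is_derive_cst _ _ _))).
rewrite /GRing.scale/=.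
move: (Re p.[_]) (Im p.[_]) (Re p^`().[_]) (Im p^`().[_]) (cos t) (sin t).
by move=> *; ring.
Qed.

(** Yields Parseval on the circle by induction on p: |zp + a|^2 = |p|^2 + |a|^2 + 2 Re(conj(a) z p)
    for |z| = 1, and the cross term has a periodic antiderivative, which contributes nothing over a
    period. *)
Lemma nsq_horner_antiderivative p : exists F : R -> R,
  (forall t, is_derive t 1 F (nsq p.[expi t])) /\
  F (pi *+ 2) - F 0 = pi *+ 2 * \sum_(i < size p) nsq p`_i.
Proof.
elim/poly_ind: p => [|p a [F [F' FE]]].
  exists (cst 0); rewrite size_poly0 big_ord0 mulr0 subrr; split=> // t.
  by rewrite horner0 nsq0; exact: is_derive_cst.
have nsqE s : nsq (p * 'X + a%:P).[expi s] =
    nsq p.[expi s] + nsq a + 2 * Re (a^* * expi s * p.[expi s]).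
  rewrite hornerMXaddC; have := cos2Dsin2 s.
  rewrite /nsq !(ReD, ImD, ReM, ImM) Re_conj Im_conj /=.
  move: (Re _) (Im _) (cos s) (sin s) (Re a) (Im a) => x y c d k l cd.
  rewrite (_ : x ^+ 2 + y ^+ 2 = (x ^+ 2 + y ^+ 2) * (c ^+ 2 + d ^+ 2)); first by ring.
  by rewrite cd mulr1.
(* Chosen so that q' = -i conj(a) p, hence q(e^(it)) has derivative conj(a) e^(it) p(e^(it)). At i =
   0 division by zero makes the constant term 0. *)
pose q : {poly R[i]} := (- 'i * a^*) *: \poly_(i < (size p).+1) (p`_i.-1 / i%:R).
have qE : q^`() = (- 'i * a^*) *: p.
  rewrite derivZ; congr (_ *: _); apply/polyP => i; rewrite coef_deriv coef_poly ltnS.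
  case: ltnP => [ip|/leq_sizeP ->//]; last by rewrite mul0rn.
  by rewrite -[LHS]mulr_natr divfK// pnatr_eq0.
exists (F + (fun s => nsq a * s) + (fun s => 2 * Re q.[expi s])); split.
  move=> t; have [qr _] := is_derive_horner_expi q t.
  have -> : (fun s => nsq a * s) = nsq a \*: id by [].
  have -> : (fun s => 2 * Re q.[expi s]) = 2 \*: (fun s => Re q.[expi s]) by [].
  apply: (is_derive_eq (is_deriveD (is_deriveD (F' t)
    (is_deriveZ _ (is_derive_id t 1))) (is_deriveZ _ qr))).
  rewrite nsqE qE hornerZ /GRing.scale/= mulr1.
  congr (_ + 2 * Re _); move: (expi t) p.[_] (a^*) => e b d.
  have ii : 'i * 'i = -1 :> R[i] by rewrite -expr2 sqr_i.
  transitivity (- ('i * 'i) * (d * e * b)); first by ring.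
  by rewrite ii opprK mul1r.
have expi2pi : expi (pi *+ 2) = expi (0 : R) by rewrite /expi cos2pi sin2pi cos0 sin0.
rewrite !fctE expi2pi (@sum_nsq_coef _ _ (size p).+1); last first.
  apply: leq_trans (size_polyD _ _) _; rewrite geq_max.
  rewrite (leq_trans (size_polyC_leq1 _))// andbT.
  by have [->|p0] := eqVneq p 0; rewrite ?mul0r ?size_poly0// size_mulX.
rewrite big_ord_recl coefD coefMX coefC/= add0r.
under eq_bigr => j _ do rewrite coefD coefMX coefC/= addr0 add0n.
transitivity (F (pi *+ 2) - F 0 + nsq a * (pi *+ 2)); first by ring.
by rewrite [RHS]mulrDr FE addrC [nsq a * _]mulrC.
Qed.

Lemma continuous_nsq_horner_expi p : continuous (fun t => nsq p.[expi t]).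
Proof.
move=> t; have [p1 p2] := is_derive_horner_expi p t.
have cont (f : R -> R) df : is_derive t 1 f df -> {for t, continuous f}.
  move=> fd; apply: differentiable_continuous; apply/derivable1_diffP.
  exact: ex_derive.
have c1 := cont _ _ p1; have c2 := cont _ _ p2.
by apply: cvgD; rewrite expr2; apply: cvgM.
Qed.

Definition period : set R := `[0, pi *+ 2[%classic.

Lemma Parseval_circle p :
  (\int[@lebesgue_measure R]_(t in period) (nsq p.[expi t])%:E)%E =
  (pi *+ 2 * \sum_(i < size p) nsq p`_i)%:E.
Proof.
have pi2 : 0 < pi *+ 2 :> R by rewrite pmulrn_lgt0// pi_gt0.
have cp := @continuous_nsq_horner_expi p.
rewrite /period integral_itv_bndo_bndc; last first.
  apply/measurable_EFinP; apply: measurable_funTS.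
  exact: continuous_measurable_fun.
have [F [F' <-]] := nsq_horner_antiderivative p.
have cF : continuous F.
  move=> t; apply: differentiable_continuous; apply/derivable1_diffP.
  exact: (@ex_derive _ _ _ _ _ _ _ (F' t)).
rewrite (@continuous_FTC2 _ _ F _ _ pi2).
- by rewrite EFinB.
- exact: continuous_subspaceT.
- split.
  + by move=> t _; exact: (@ex_derive _ _ _ _ _ _ _ (F' t)).
  + by apply: cvg_at_right_filter; exact: cF.
  + by apply: cvg_at_left_filter; exact: cF.
- move=> t _; rewrite derive1E; exact: (@derive_val _ _ _ _ _ _ _ (F' t)).
Qed.

(* Cauchy-Schwarz against the coefficients of the Szego kernel. *)
Lemma nsq_horner_le p z : nsq z < 1 ->
  nsq p.[z] * (1 - nsq z) <= \sum_(i < size p) nsq p`_i.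
Proof.
move=> z1; have z10 : 0 < 1 - nsq z by rewrite subr_gt0.
pose s (x y : R[i]^o) : R[i] := x * y^*.
have P : psd_form s.
  split=> [w a x y|x y|x]; first by rewrite /s mulrDl -mulrA.
    by rewrite /s rmorphM/= conjCK mulrC.
  by rewrite /s mul_conjC/= nsq_ge0.
have sE x : qform s x = nsq x by rewrite /qform /s mul_conjC.
have := qform_sum_le P (size p) (fun i => p`_i) (fun i => z ^+ i : R[i]^o).
rewrite sE -horner_coef => le_p.
apply: le_trans (ler_wpM2r (ltW z10) le_p) _; rewrite -mulrA ler_piMr//.
  by apply: sumr_ge0 => i _; exact: nsq_ge0.
rewrite -ler_pdivlMr//; under eq_bigr do rewrite sE nsqX.
have z01 : 0 <= nsq z < 1 by rewrite nsq_ge0.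
by have := geometric_tail_le 0 (size p) z01; rewrite expr0.
Qed.

End CircleIntegral.

(** * Bounds on an inner function and its Taylor coefficients *)

Section InnerFunction.
Variables (R : realType) (u : R[i] -> R[i]).
Hypothesis u_inner : inner_function u.
Local Notation c := (taylor_coef u).
Variable N : nat -> nat.
Hypothesis N_approx : forall k, approximates u c k (N k).
Local Notation p k := (psum c (radius R k) (N k)).

Lemma taylor_coefP : disc_expansion u c.
Proof. by case: u_inner => -[a ua] _ _; apply: xgetPex; exists a. Qed.

(** Almost everywhere |p_k(e^(it))| tends to 1; dominated convergence gives the limit of the means
    of |p_k|^(2m), and Parseval rewrites them by coefficients. *)
Lemma approximant_mean_cvg m :
  \sum_(i < size (p k ^+ m)) nsq (p k ^+ m)`_i @[k --> \oo] --> (1 : R).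
Proof.
have [_ [M uM] u_ae] := u_inner.
have pi2 : 0 < pi *+ 2 :> R by rewrite pmulrn_lgt0// pi_gt0.
(* [B] is the given bound of u, made real; that 1 is a bound is deduced from this lemma
   afterwards. *)
have {M uM} [B B0 uB] : exists2 B, 0 <= B & forall z, disc z -> cabs (u z) <= B.
  have d0 : disc (0 : R[i]) by apply/discE; rewrite cabs0.
  have := le_trans (normr_ge0 _) (uM _ d0) => M0.
  exists (Re M); first by move: M0; rewrite lecE => /andP[].
  by move=> z /uM; rewrite cabsE lecE => /andP[].
have pB k t : nsq (p k).[expi t] <= (B + 1) ^+ 2.
  rewrite nsq_le_cabs ?addr_ge0//; have [_ Np _] := N_approx k.
  have t1 : cabs (expi t) <= 1 by rewrite cabs_expi.
  have := Np _ t1; have := uB _ (disc_scale (radius_itv R k) t1).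
  move: (u _) => w w1 h.
  have -> : (p k).[expi t] = w + - (w - (p k).[expi t]) by rewrite opprB addrC subrK.
  apply: le_trans (cabsD_le _ _) _; rewrite cabsN lerD//; apply: le_trans h _.
  by rewrite invf_le1 ?ler1n ?ltr0n.
pose D : set (measurableTypeR R) := @period R.
pose f k := EFin \o (fun t : R => nsq (p k ^+ m).[expi t]).
have mf k : measurable_fun D (f k).
  apply/measurable_EFinP; apply: measurable_funTS.
  apply: continuous_measurable_fun.
  exact: continuous_nsq_horner_expi.
have f_ae : \forall t \ae (@lebesgue_measure R), D t -> f ^~ t @ \oo --> (1 : R)%:E.
  have [Z [mZ Z0 subZ]] := u_ae; exists Z; split => //.
  apply: subset_trans subZ; apply: subsetC => t /= ut.
  rewrite /D/period/= in_itv/= => t02.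
  have [|w w1 uw] := ut; first by rewrite mulr_natl.
  have uk := cvg_comp _ _ (@cvg_radius R) uw.
  have pk : cabs (p k).[expi t] @[k --> \oo] --> (1 : R).
    apply/cvgrPdist_le => e e0; have e2 : 0 < e / 2 by lra.
    have [k1 k1P] := cvgC_cabs uk e2.
    have [k2 k2P] := inv_nat_small e2.
    exists (maxn k1 k2) => // k /=; rewrite geq_max => /andP[/k1P h1 /k2P h2].
    have [_ Np _] := N_approx k.
    have := Np (expi t); rewrite cabs_expi lexx => /(_ isT) h3.
    have cw : cabs w = 1 by apply: (@complexI R); rewrite -cabsE w1.
    move: h1 h3; rewrite /=; move: (u _) (p k).[_] => a b h1 h3.
    have wb : cabs (w - b) <= e.
      have -> : w - b = (w - a) + (a - b) by ring.
      apply: le_trans (cabsD_le _ _) _; rewrite [leRHS](splitr e).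
      by rewrite lerD// (le_trans h3 h2).
    have b1 : cabs b <= cabs w + cabs (w - b).
      by rewrite -{1}(subKr w b); apply: le_trans (cabsD_le _ _) _; rewrite cabsN.
    have b2 : cabs w <= cabs b + cabs (w - b).
      by rewrite -{1}(subrK b w) addrC; exact: cabsD_le.
    rewrite -cw ler_distl lerBlDr (le_trans b1) ?lerD2l//.
    by rewrite (le_trans b2)// lerD2l.
  apply/cvg_EFin; first by apply: nearW => k.
  have -> : fine \o f ^~ t = fun k => (cabs (p k).[expi t] ^+ 2) ^+ m.
    by apply/funext => k; rewrite /f/= horner_exp nsqX sqr_cabs.
  rewrite -(expr1n R m) -(expr1n R 2).
  have cvgX (v : nat -> R) (l : R) n : v k @[k --> \oo] --> l ->
      v k ^+ n @[k --> \oo] --> l ^+ n.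
    by move=> vl; exact: (cvg_comp v (fun x => x ^+ n) vl (@exprn_continuous _ n l)).
  by apply: (cvgX (fun k => _ ^+ 2)); apply: cvgX.
have muD : (@lebesgue_measure R) D = (pi *+ 2)%:E.
  by rewrite /D /period lebesgue_measure_itv/= lte_fin pi2 -EFinB subr0.
have ig : (@lebesgue_measure R).-integrable D (fun=> ((B + 1) ^+ 2 ^+ m)%:E).
  apply/integrableP; split; first exact: measurable_cst.
  rewrite integral_cst//; last exact: measurable_itv.
  by rewrite [X in (_ * X)%E](_ : _ = (pi *+ 2)%:E) ?muD// -EFinM ltry.
have f_le : \forall t \ae (@lebesgue_measure R),
    forall k, D t -> (`|f k t| <= ((B + 1) ^+ 2 ^+ m)%:E)%E.
  apply: aeW => t k _; rewrite /f/= lee_fin ger0_norm ?nsq_ge0// horner_exp nsqX.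
  by rewrite lerXn2r ?nnegrE ?nsq_ge0// exprn_ge0// addr_ge0.
have mD : measurable D by exact: measurable_itv.
have [_ _] := dominated_convergence mD mf (measurable_cst (1%:E : \bar R)) f_ae ig f_le.
rewrite integral_cst// [X in (1 * X)%E](_ : _ = (pi *+ 2)%:E) ?muD// mul1e.
have -> : [sequence (\int[@lebesgue_measure R]_(x in D) f k x)%E]_k =
    (fun k => (pi *+ 2 * \sum_(i < size (p k ^+ m)) nsq (p k ^+ m)`_i)%:E).
  by apply/funext => k; exact: Parseval_circle.
move=> /fine_cvgP[_ /= h].
rewrite (_ : (fun k => _) = (fun k => (pi *+ 2)^-1 *
    (pi *+ 2 * \sum_(i < size (p k ^+ m)) nsq (p k ^+ m)`_i))); last first.
  by apply/funext => k; rewrite mulKf// gt_eqF.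
have -> : 1 = (pi *+ 2)^-1 * (pi *+ 2) :> R by rewrite mulVf// gt_eqF.
by apply: cvgM => //; exact: cvg_cst.
Qed.

Lemma approximant_norm_cvg :
  \sum_(i < size (p k)) nsq (p k)`_i @[k --> \oo] --> (1 : R).
Proof. by have := approximant_mean_cvg 1; under eq_fun do rewrite expr1. Qed.

(** Applying [nsq_horner_le] to the powers p_k^m and letting k grow gives |u(z)|^(2m) d <= 1 with d
    > 0 independent of m; Bernoulli then excludes |u(z)| > 1. *)
Lemma inner_le1 z : disc z -> cabs (u z) <= 1.
Proof.
move=> /discE z1; have z21 : nsq z < 1 by rewrite -sqr_cabs expr_lt1// cabs_ge0.
have z20 := nsq_ge0 z.
pose d := (1 - nsq z) / 2; have d0 : 0 < d by rewrite divr_gt0// subr_gt0.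
have rk0 k : 0 < radius R k.
  by rewrite subr_gt0 invf_lt1 ?ltr0n// ltr1n.
(* p_k approximates u at radius times its argument, so it has to be evaluated at [w k] to reach
   u(z); halving 1 - |z|^2 in [d] leaves room for |w_k| > |z|. *)
pose w k := (radius R k)^-1%:C * z.
have nw k : nsq (w k) = (radius R k)^-1 * (radius R k)^-1 * nsq z.
  by rewrite nsqM nsq_real expr2.
have wz k : (radius R k)%:C * w k = z.
  by rewrite mulrA -rmorphM divff ?mul1r// gt_eqF.
have nw_cvg : nsq (w k) @[k --> \oo] --> nsq z.
  have -> : (fun k => nsq (w k)) =
      fun k => (radius R k)^-1 * (radius R k)^-1 * nsq z by apply/funext => k.
  have rV : (radius R k)^-1 @[k --> \oo] --> (1 : R).
    by rewrite -[X in _ --> X]invr1; apply: cvgV => //; exact: cvg_radius1.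
  have h : (radius R k)^-1 * (radius R k)^-1 * nsq z @[k --> \oo] --> 1 * 1 * nsq z.
    by apply: cvgM; [exact: cvgM|exact: cvg_cst].
  by rewrite !mul1r in h.
have w_near : \forall k \near \oo, nsq (w k) <= 1 - d.
  have dz : nsq z < 1 - d by rewrite /d; lra.
  by apply: (cvgr_le _ nw_cvg).
have pw_cvg : nsq (p k).[w k] @[k --> \oo] --> nsq (u z).
  under eq_fun do rewrite -sqr_cabs; rewrite -sqr_cabs.
  suff h : cabs (p k).[w k] @[k --> \oo] --> cabs (u z).
    exact: (cvg_comp _ (fun x => x ^+ 2) h (@exprn_continuous _ 2 _)).
  apply/cvgrPdist_le => e e0; have [k0 k0P] := inv_nat_small e0.
  near=> k; have [_ Np _] := N_approx k.
  have w1 : cabs (w k) <= 1.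
    rewrite -nsq_le_cabs ?ler01// expr1n; apply: (@le_trans _ _ (1 - d)).
      by near: k.
    by rewrite gerBl ltW.
  have := Np _ w1; rewrite wz => h.
  have he : cabs (u z - (p k).[w k]) <= e.
    by apply: le_trans h _; apply: k0P; near: k; exists k0.
  rewrite ler_distl; apply/andP; split.
    rewrite lerBlDr -{1}(subKr (u z) (p k).[w k]).
    by apply: le_trans (cabsD_le _ _) _; rewrite cabsN lerD2l.
  rewrite -{1}(subrK (p k).[w k] (u z)) addrC.
  by apply: le_trans (cabsD_le _ _) _; rewrite lerD2l.
have uzm m : nsq (u z) ^+ m * d <= 1.
  apply: (ler_cvg_to _ (@approximant_mean_cvg m)).
    apply: cvgM; last exact: cvg_cst.
    exact: (cvg_comp _ (fun x => x ^+ m) pw_cvg (@exprn_continuous _ m _)).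
  apply: filterS w_near => k wk /=.
  have wk1 : nsq (w k) < 1 by apply: le_lt_trans wk _; rewrite gtrBl.
  apply: le_trans (nsq_horner_le (p k ^+ m) wk1).
  rewrite horner_exp nsqX ler_wpM2l ?exprn_ge0 ?nsq_ge0//.
  by rewrite lerBrDr addrC -lerBrDr.
rewrite -nsq_le_cabs ?ler01// expr1n leNgt; apply/negP => u1.
pose y := nsq (u z) - 1; have y0 : 0 < y by rewrite subr_gt0.
have bern m : 1 + m%:R * y <= nsq (u z) ^+ m.
  elim: m => [|m IH]; first by rewrite mul0r addr0 expr0.
  rewrite exprS; apply: le_trans (ler_wpM2l (nsq_ge0 _) IH).
  have -> : nsq (u z) = 1 + y by rewrite /y addrC subrK.
  by rewrite -subr_ge0 -natr1; have := mulr_ge0 (ler0n R m) (sqr_ge0 y); lra.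
have dy0 : 0 < d * y by exact: mulr_gt0.
pose m := (Num.truncn (d * y)^-1).+1.
have my : 1 < m%:R * (d * y) by rewrite -ltr_pdivrMr// mul1r truncnS_gt.
have := le_trans (ler_wpM2r (ltW d0) (bern m)) (uzm m).
rewrite mulrDl mul1r -mulrA [y * d]mulrC leNgt => /negP; apply.
by apply: lt_le_trans my _; rewrite lerDr ltW.
Unshelve. all: by end_near.
Qed.

(** The first n terms, weighted by powers of the radius, are part of the squared coefficient norm of
    p_k, which tends to 1. *)
Lemma taylor_coef_le1 n : \sum_(i < n) nsq (c i) <= 1.
Proof.
pose f : {poly R} := \sum_(i < n) (nsq (c i))%:P * 'X^(i * 2).
have fE r : f.[r] = \sum_(i < n) nsq (c i) * r ^+ (i * 2).
  by rewrite horner_sum; apply: eq_bigr => i _; rewrite !hornerE.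
have -> : \sum_(i < n) nsq (c i) = f.[1].
  by rewrite fE; apply: eq_bigr => i _; rewrite expr1n mulr1.
have f_cvg : f.[radius R k] @[k --> \oo] --> f.[1].
  exact: (cvg_comp _ _ (@cvg_radius1 R) (@continuous_horner _ f 1)).
apply: (ler_cvg_to f_cvg approximant_norm_cvg).
exists n => // k /= nk; have [kN _ _] := N_approx k.
have nN : (n <= N k)%N by rewrite (leq_trans nk)// ltnW.
have sN : (size (p k) <= N k)%N by exact: size_poly.
rewrite fE (sum_nsq_coef sN).
apply: (@le_trans _ _ (\sum_(i < n) nsq (p k)`_i)).
  apply: ler_sum => i _; rewrite /psum coef_poly (leq_trans (ltn_ord i) nN).
  by rewrite nsqM nsqX nsq_real -exprM mulnC.
by apply: (@ler_sum_ord _ (fun i => nsq (p k)`_i) _ _ nN) => i; exact: nsq_ge0.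
Qed.

(** If |c_0| >= 1, the bound on the squared coefficients leaves nothing for the others and u is
    constant. *)
Lemma taylor_coef0_lt1 : ~ constant_on_disc u -> nsq (c 0) < 1.
Proof.
move=> u_nonconst; rewrite ltNge; apply/negP => c01.
have c0 i : (0 < i)%N -> c i = 0.
  move=> i0; apply/eqP; rewrite -nsq_eq0 eq_le nsq_ge0 andbT.
  have := taylor_coef_le1 i.+1; rewrite big_ord_recr/=.
  case: i i0 => // i _; rewrite big_ord_recl/= -addrA => /(le_trans _).
  have : 0 <= \sum_(j < i) nsq (c (lift ord0 j)).
    by apply: sumr_ge0 => j _; exact: nsq_ge0.
  move: (\sum_(j < i) _) => S S0 /(_ (1 + nsq (c i.+1))); rewrite gerDl; apply.
  by rewrite lerD// lerDr.
apply: u_nonconst; exists (c 0) => z zd.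
apply/eqP; rewrite -subr_eq0 -nsq_eq0 -sqr_cabs sqrf_eq0 eq_le cabs_ge0 andbT.
apply/ler_addgt0Pr => e e0; rewrite add0r.
have [n nP] := cvgC_cabs (taylor_coefP zd) e0; have := nP n.+1 (leqnSn n).
rewrite /series/= big_mkord big_ord_recl/= expr0 mulr1 big1 ?addr0// => i _.
by rewrite c0// mul0r.
Qed.

End InnerFunction.

(** * Comparison of the asymptotic forms *)

Section NullVectors.
Variables (R : realType) (V : lmodType R[i]) (s : V -> V -> R[i]).
Hypothesis s_psd : psd_form s.
Local Notation Q := (qform s).

(** By Cauchy-Schwarz a null vector is orthogonal to everything. *)
Lemma qform_null_add x y : Q x = 0 -> Q (x + y) = Q y.
Proof.
move=> x0; rewrite (qformD s_psd) x0 add0r.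
have := Re_psd_le s_psd (lexx (Q x)) (lexx (Q y)); rewrite x0 mul0r => h.
have /eqP : Re (s x y) ^+ 2 == 0 by rewrite eq_le h sqr_ge0.
by move=> /eqP; rewrite sqrf_eq0 => /eqP ->; rewrite mulr0 addr0.
Qed.

(** Positivity at x + ty and x - ty bounds the cross term by Q(x)/t + t Q(y); this makes forms below
    the norm continuous. *)
Lemma qform_dist_le (t : R) x y : 0 < t ->
  `|Q (x + y) - Q y| <= Q x * (1 + t^-1) + t * Q y.
Proof.
move=> t0; have h (w : R) : w ^+ 2 = t ^+ 2 -> 0 <= Q x + t ^+ 2 * Q y + 2 * w * Re (s x y).
  move=> wt; have := qform_ge0 s_psd (x + w%:C *: y).
  rewrite (qformD s_psd) (qformZ s_psd) (psdZr s_psd) nsq_real wt conj_realC ReM/=.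
  by rewrite mul0r subr0 mulrA.
have h1 := h t erefl; have h2 := h (- t) (sqrrN t).
have xt : Q x * t^-1 * t = Q x by rewrite divfK// gt_eqF.
have x0 := qform_ge0 s_psd x.
rewrite (qformD s_psd) ler_norml; apply/andP; split; rewrite -(ler_pM2r t0).
  by rewrite mulrDr mulr1 mulNr !mulrDl xt; nra.
by rewrite mulrDr mulr1 !mulrDl mulNr xt; nra.
Qed.

End NullVectors.

Section CoefficientForm.
Variable R : realType.
Implicit Types p q : {poly R[i]}.

(** The inner product of the Hardy space H^2 on polynomials; beyond [size p] the terms vanish. *)
Definition coef_form p q : R[i] := \sum_(i < size p) p`_i * (q`_i)^*.

Lemma coef_formE n p q : (size p <= n)%N ->
  coef_form p q = \sum_(i < n) p`_i * (q`_i)^*.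
Proof.
move=> pn; rewrite -(subnKC pn) big_split_ord/= [X in _ + X]big1 ?addr0// => i _.
by rewrite nth_default ?mul0r// leq_addr.
Qed.

Lemma coef_form_scalar q : scalar (coef_form^~ q).
Proof.
move=> a p1 p2; pose n := maxn (size p1) (size p2).
have n1 : (size p1 <= n)%N by exact: leq_maxl.
have n2 : (size p2 <= n)%N by exact: leq_maxr.
rewrite (@coef_formE n); last first.
  apply: leq_trans (size_polyD _ _) _; rewrite geq_max n2 andbT.
  exact: leq_trans (size_scale_leq _ _) n1.
rewrite (coef_formE _ n1) (coef_formE _ n2) mulr_sumr -big_split.
by apply: eq_bigr => i _; rewrite coefD coefZ mulrDl mulrA.
Qed.

Lemma coef_formC p q : coef_form q p = (coef_form p q)^*.
Proof.
rewrite (coef_formE _ (leq_maxl (size q) (size p))).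
rewrite (coef_formE _ (leq_maxr (size q) (size p))) rmorph_sum.
by apply: eq_bigr => i _; rewrite rmorphM/= conjCK mulrC.
Qed.

Lemma coef_form_self p : coef_form p p = (\sum_(i < size p) nsq p`_i)%:C.
Proof. by rewrite rmorph_sum; apply: eq_bigr => i _; rewrite mul_conjC. Qed.

Lemma coef_formMX p : coef_form (p * 'X) (p * 'X) = coef_form p p.
Proof.
have h : (size (p * 'X)%R <= (size p).+1)%N.
  by have [->|p0] := eqVneq p 0; rewrite ?mul0r ?size_poly0// size_mulX.
rewrite (coef_formE _ h) big_ord_recl coefMX/= mul0r add0r.
by apply: eq_bigr => i _; rewrite coefMX.
Qed.

End CoefficientForm.

(** * Invariance of each asymptotic form under the other operator *)

Section AsymptoticForms.
Variables (R : realType) (H : completeNormedModType R[i]).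
Variables (dot : {dot H for (@Num.conj R[i])}).
Hypothesis dot_norm : hilbert_norm dot.
Local Notation Q := (qform dot).

Lemma cvg_dominated_qform (s : H -> H -> R[i]) (f : nat -> H) l :
  psd_form s -> (forall x, qform s x <= Q x) -> f n @[n --> \oo] --> l ->
  qform s (f n) @[n --> \oo] --> qform s l.
Proof.
move=> P sQ fl; apply/cvgrPdist_le => e e0.
have q0 := qform_ge0 P l.
pose t := e / 2 / (qform s l + 1).
have t0 : 0 < t by rewrite !divr_gt0//; lra.
have ti : 0 < 1 + t^-1 by have : 0 < t^-1 by [rewrite invr_gt0]; lra.
have tq : t * qform s l <= e / 2.
  by rewrite mulrC mulrCA ler_piMr ?divr_ge0 ?(ltW e0)// ler_pdivrMr ?mul1r; lra.
have [n0 nP] := (cvg_qform_seq dot_norm _ _).1 fl _ (divr_gt0 (divr_gt0 e0 (ltr0n _ 2)) ti).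
exists n0 => // n /= /nP le_n; rewrite distrC -{1}(subrK l (f n)).
apply: le_trans (qform_dist_le P _ _ t0) _; rewrite [leRHS](splitr e) lerD//.
by rewrite -ler_pdivlMr//; apply: le_trans (sQ _) le_n.
Qed.

(** An S-invariant form below Q is below every Q(S^n x), hence below their limit: the asymptotic
    form is the largest such form. *)
Lemma le_asymptotic_form (s : H -> H -> R[i]) (S : {linear H -> H}) :
  (forall x, Q (S x) <= Q x) ->
  (forall x, qform s x <= Q x) -> (forall x, qform s (S x) = qform s x) ->
  forall x, qform s x <= qform (asymptotic_form dot S) x.
Proof.
move=> SC sQ sS x.
have c := @asymptotic_qform_cvg _ _ _ dot_norm _ SC x.
apply: (cvgr_to_ge c); apply: nearW => n.
by elim: n x {c} => // n IH x; rewrite -sS iterSr; exact: IH.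
Qed.

Variable T : {linear H -> H}.
Hypothesis T_contr : forall x, Q (T x) <= Q x.
Hypothesis T_cnu : completely_nonunitary dot T.
Variable F : {linear H -> H}.
Hypothesis FT : forall x, F (T x) = T (F x).
Variable p : nat -> {poly R[i]}.
Hypothesis pF : forall x, polyop T (p k) x @[k --> \oo] --> F x.
Hypothesis p_le : forall k z, nsq z = 1 -> nsq (p k).[z] <= (1 + k.+1%:R^-1) ^+ 2.
Hypothesis p_norm : \sum_(i < size (p k)) nsq (p k)`_i @[k --> \oo] --> (1 : R).
Variable a0 : R[i].
Hypothesis p_coef0 : forall k, (p k)`_0 = a0.
Hypothesis a0_lt1 : nsq a0 < 1.

Lemma cvg_bound (q : R) : (1 + k.+1%:R^-1) ^+ 2 * q @[k --> \oo] --> q.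
Proof.
have h : (1 + k.+1%:R^-1 : R) @[k --> \oo] --> (1 : R).
  rewrite -[X in _ --> X]addr0; apply: cvgD; [exact: cvg_cst|exact: cvg_harmonic].
rewrite -[X in _ --> X]mul1r -[X in X * q](expr1n R 2).
apply: cvgM; last exact: cvg_cst.
exact: (cvg_comp _ (fun x => x ^+ 2) h (@exprn_continuous _ 2 _)).
Qed.

(** The von Neumann inequality for the p_k, whose bounds on the circle tend to 1, passes to the
    limit. *)
Lemma inner_contr (s : H -> H -> R[i]) : psd_form s ->
  (forall x, qform s x <= Q x) -> (forall x, qform s (T x) <= qform s x) ->
  forall x, qform s (F x) <= qform s x.
Proof.
move=> P sQ sT x.
apply: (ler_cvg_to (cvg_dominated_qform P sQ (@pF x)) (@cvg_bound (qform s x))).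
by apply: nearW => k; exact: (von_neumann P _ sT (@p_le k)).
Qed.

Lemma F_contr x : Q (F x) <= Q x.
Proof. exact: (inner_contr (dot_psd dot)). Qed.

(* Multiplication by X on polynomials is isometric for the form beta, so the
   von Neumann inequality for beta bounds the forms alpha from below. *)
Lemma asymptotic_form_codefect h (y := h - T (adjoint dot T h)) :
  qform (asymptotic_form dot T) y <= qform (asymptotic_form dot T) (F y).
Proof.
set s := asymptotic_form dot T.
have P : psd_form s := asymptotic_form_psd dot_norm T_contr.
have sQ x : qform s x <= Q x := asymptotic_qform_le dot_norm T_contr 0 x.
have sT x : qform s (T x) = qform s x.
  by rewrite /qform /s (asymptotic_formT dot_norm T_contr).
pose beta (f g : {poly R[i]}) : R[i] :=
  (Q h)%:C * coef_form f g - s (polyop T f y) (polyop T g y).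
have betaE f : qform beta f =
    Q h * \sum_(i < size f) nsq f`_i - qform s (polyop T f y).
  by rewrite /qform /beta coef_form_self -rmorphM ReD ReN.
have B : psd_form beta.
  split=> [g b f1 f2|f g|f].
  - rewrite /beta coef_form_scalar polyopD polyopZ (psdP P); ring.
  - rewrite /beta rmorphB rmorphM/= conj_realC -coef_formC -(psdC P) //.
  - rewrite -/(qform beta f) betaE subr_ge0 mulrC.
    exact: le_trans (sQ _) (polyop_codefect_le dot_norm T_contr f h).
pose X : {linear {poly R[i]} -> {poly R[i]}} := 'X \o* idfun.
have XB f : qform beta (X f) <= qform beta f.
  rewrite {1}/qform /beta /= coef_formMX !polyopMX.
  have := sT (polyop T f y); rewrite /qform => sTf.
  by rewrite ReD ReN sTf -ReN -ReD.
(* Hence the von Neumann inequality for [X] at the polynomial 1 speaks of [p k] itself. *)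
have XE f : polyop X f 1 = f.
  rewrite /polyop -[RHS]coefK poly_def; apply: eq_bigr => i _; congr (_ *: _).
  by elim: (nat_of_ord i) => //= n ->; rewrite exprSr.
have le_k k : Q h * (\sum_(i < size (p k)) nsq (p k)`_i) - qform s (polyop T (p k) y) <=
    (1 + k.+1%:R^-1) ^+ 2 * (Q h - qform s y).
  have := von_neumann B 1 XB (@p_le k); rewrite XE !betaE.
  by rewrite size_poly1 big_ord1 coefC/= nsq1 mulr1 polyopC scale1r.
have cl : Q h * (\sum_(i < size (p k)) nsq (p k)`_i) - qform s (polyop T (p k) y)
    @[k --> \oo] --> Q h * 1 - qform s (F y).
  by apply: cvgB; [apply: cvgM => //; exact: cvg_cst|exact: cvg_dominated_qform].
suff : Q h * 1 - qform s (F y) <= Q h - qform s y by rewrite mulr1 lerD2l lerN2.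
by apply: (ler_cvg_to cl (@cvg_bound _)); apply: nearW.
Qed.

(** The defect form d of F is T-invariant, as F commutes with T, so its null space passes both ways
    along T; [cnu_induction] leaves the vectors of [asymptotic_form_codefect]. *)
Lemma asymptotic_form_inner x :
  qform (asymptotic_form dot T) (F x) = qform (asymptotic_form dot T) x.
Proof.
set s := asymptotic_form dot T.
have P : psd_form s := asymptotic_form_psd dot_norm T_contr.
have sQ y : qform s y <= Q y := asymptotic_qform_le dot_norm T_contr 0 y.
have sT y : qform s (T y) = qform s y.
  by rewrite /qform /s (asymptotic_formT dot_norm T_contr).
have sT' y : qform s (T y) <= qform s y by rewrite sT.
have sF := inner_contr P sQ sT'.
have D := psd_defect P sF; set d := defect_form s F in D.
have dE y : qform d y = qform s y - qform s (F y) := qform_defect s F y.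
have dQ y : qform d y <= Q y.
  by rewrite dE; apply: le_trans (sQ y); rewrite gerBl; exact: qform_ge0.
have d0 y : qform d y <= 0 -> qform d y = 0.
  by move=> h; apply/eqP; rewrite eq_le h (qform_ge0 D).
have dT y : qform d (T y) = qform d y by rewrite !dE FT !sT.
suff : [set y | qform d y = 0] x by rewrite /= dE => /eqP; rewrite subr_eq0 => /eqP.
apply: (cnu_induction dot_norm T_contr T_cnu) => {x}.
- split.
  + apply/(closed_qformP dot_norm) => x xG; apply: d0; apply/ler_addgt0Pr => e e0.
    have [y /= yG le_y] := xG _ (divr_gt0 e0 (ltr0n _ 2)).
    rewrite add0r; apply: le_trans (qform_le D x y) _.
    by rewrite yG; have := dQ (x - y); lra.
  + exact: qform0 D.
  + move=> b x y /= x0 y0; rewrite qform_null_add//.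
    by rewrite (qformZ D) x0 mulr0.
- by move=> h; apply: d0; rewrite dE subr_le0; exact: asymptotic_form_codefect.
- by move=> y /=; rewrite dT.
- by move=> y /=; rewrite dT.
Qed.

(* d is both F-invariant and multiplied by |a0|^2 under F, since the defect
   term of the von Neumann inequality makes F - a0 vanish for d. *)
Lemma asymptotic_form_of_inner x :
  qform (asymptotic_form dot F) (T x) = qform (asymptotic_form dot F) x.
Proof.
set s := asymptotic_form dot F.
have P : psd_form s := asymptotic_form_psd dot_norm F_contr.
have sQ y : qform s y <= Q y := asymptotic_qform_le dot_norm F_contr 0 y.
have sF y : qform s (F y) = qform s y.
  by rewrite /qform /s (asymptotic_formT dot_norm F_contr).
have FnT n y : iter n F (T y) = T (iter n F y).
  by elim: n => //= n ->; rewrite FT.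
have sT y : qform s (T y) <= qform s y.
  have c := @asymptotic_qform_cvg _ _ _ dot_norm _ F_contr.
  apply: (ler_cvg_to (c (T y)) (c y)); apply: nearW => n.
  by rewrite FnT; exact: T_contr.
have D := psd_defect P sT; set d := defect_form s T in D.
have dE y : qform d y = qform s y - qform s (T y) := qform_defect s T y.
have dQ y : qform d y <= Q y.
  by rewrite dE; apply: le_trans (sQ y); rewrite gerBl; exact: qform_ge0.
(* With p_k = qX + a0, the defect term at the vector Ty concerns q(T)Ty = p_k(T)y - a0 y. The zero
   polynomial forces a0 = 0. *)
have le_k y k : qform d (polyop T (p k) y - a0 *: y) <=
    (1 + k.+1%:R^-1) ^+ 2 * qform s (T y) - qform s (polyop T (p k) (T y)).
  have := p_coef0 k; have := @p_le k; elim/poly_ind: (p k) => [|q b _] qb.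
    rewrite coef0 => <-; rewrite /polyop size_poly0 !big_ord0 scale0r subrr.
    by rewrite (qform0 D) (qform0 P) subr0 mulr_ge0 ?(qform_ge0 P).
  rewrite coefD coefMX coefC/= add0r => ba; have := von_neumann_defect P (T y) sT qb.
  rewrite -dE polyop_comm// -lerBrDl; apply: le_trans.
  by rewrite polyopD polyopMX polyopC ba addrK polyop_comm.
have dF y : qform d (F y - a0 *: y) = 0.
  apply/eqP; rewrite eq_le (qform_ge0 D) andbT.
  have c1 : polyop T (p k) y - a0 *: y @[k --> \oo] --> F y - a0 *: y.
    by apply: cvgB; [exact: pF|exact: cvg_cst].
  have c2 : (1 + k.+1%:R^-1) ^+ 2 * qform s (T y) - qform s (polyop T (p k) (T y))
      @[k --> \oo] --> qform s (T y) - qform s (F (T y)).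
    by apply: cvgB; [exact: cvg_bound|exact: cvg_dominated_qform].
  have <- : qform s (T y) - qform s (F (T y)) = 0 by rewrite sF subrr.
  by apply: (ler_cvg_to (cvg_dominated_qform D dQ c1) c2); apply: nearW.
have dx : qform d x = nsq a0 * qform d x.
  rewrite -(qformZ D) -[RHS](qform_null_add D _ (dF x)) subrK !dE.
  by rewrite -FT !sF.
apply/eqP; rewrite eq_sym -subr_eq0 -dE; apply/eqP.
have : (1 - nsq a0) * qform d x = 0 by rewrite mulrBl mul1r -dx subrr.
by move/eqP; rewrite mulf_eq0 subr_eq0 eq_sym lt_eqF//= => /eqP.
Qed.

(** Each form is invariant under the other operator and below Q, so maximality in
    [le_asymptotic_form] gives both inequalities. *)
Theorem asymptotic_limit_inner : asymptotic_limit dot T = asymptotic_limit dot F.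
Proof.
apply: (asymptotic_limit_eq dot_norm T_contr F_contr) => x.
have lT := asymptotic_qform_le dot_norm T_contr 0.
have lF := asymptotic_qform_le dot_norm F_contr 0.
apply/eqP; rewrite eq_le.
rewrite (le_asymptotic_form F_contr lT asymptotic_form_inner).
by rewrite (le_asymptotic_form T_contr lF asymptotic_form_of_inner).
Qed.

End AsymptoticForms.

(** * Assembly for an inner function u and F = u(T) *)

Theorem theorem4 (R : realType) (H : completeNormedModType R[i])
  (dot : {dot H for (@Num.conj R[i])}) (dot_norm : hilbert_norm dot)
  (u : R[i] -> R[i]) (u_inner : inner_function u)
  (u_nonconst : ~ constant_on_disc u)
  (T : {linear H -> H}) (T_contr : contractive T)
  (T_cnu : completely_nonunitary dot T) :
  asymptotic_limit dot T = asymptotic_limit dot (calculus u T).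
Proof.
have TQ x : qform dot (T x) <= qform dot x by rewrite -(norm_le2 dot_norm).
have uc := taylor_coefP u_inner.
have [N NP] := approximant_exists uc.
have u1 := inner_le1 u_inner NP.
have c1 := taylor_coef_le1 u_inner NP.
have c0 := taylor_coef0_lt1 u_inner NP u_nonconst.
pose F : {linear H -> H} := HB.pack (calculus u T)
  (GRing.isLinear.Build _ _ _ _ (calculus u T)
    (calculus_linear dot_norm TQ T_cnu uc u1 c1 NP)).
have FT x : F (T x) = T (F x) := calculus_comm dot_norm TQ T_cnu uc u1 c1 NP x.
have pF x := @calculus_approx _ _ _ dot_norm _ TQ T_cnu _ uc u1 c1 _ NP x.
have p_le k z : nsq z = 1 ->
    nsq (psum (taylor_coef u) (radius R k) (N k)).[z] <= (1 + k.+1%:R^-1) ^+ 2.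
  move=> /cabs1_nsq z1; rewrite nsq_le_cabs ?addr_ge0//.
  by rewrite (approximant_le u1 NP)// z1.
have p0 k : (psum (taylor_coef u) (radius R k) (N k))`_0 = taylor_coef u 0.
  have [kN _ _] := NP k.
  by rewrite coef_poly (leq_ltn_trans (leq0n k) kN) expr0 mulr1.
exact: (@asymptotic_limit_inner _ _ _ dot_norm _ TQ T_cnu F FT _ pF p_le
  (approximant_norm_cvg u_inner NP) _ p0 c0).
Qed.
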